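(* Let $K$ be a compact Hausdorff space and $X$ be a complex Banach space. If, for every $S\in\mathrm{Lip}_0(X,X)$, the range of the mapping $Q_S:A(K,X)\to C(K,X)$ given by $Q_S(f)(t)=S(f(t))$ ($f\in A(K,X)$, $t\in K$) is contained in $A(K,X)$, then $n_L(X)=n_L(A(K,X))$.
   Context: All Banach spaces are complex. $C(K,X)$ is the Banach space of continuous functions $K\to X$ with the supremum norm, and $C(K)=C(K,\mathbb{C})$. A uniform algebra on $K$ is a closed subspace (subalgebra) of $C(K)$ that separates the points of $K$ and contains the constants. $A(K,X)$ denotes a closed subspace of $C(K,X)$ such that: (i) the base algebra $A=\{x^*\circ f: f\in A(K,X),\ x^*\in X^*\}$ is a uniform algebra; (ii) $A\otimes X\subset A(K,X)$ (i.e. $t\mapsto\varphi(t)x$ is in $A(K,X)$ for $\varphi\in A$, $x\in X$); (iii) $fg\in A(K,X)$ for every $f\in A$, $g\in A(K,X)$. For a Banach space $Z$, $\mathrm{Lip}_0(Z,Z)$ is the space of Lipschitz maps $T:Z\to Z$ with $T(0)=0$ and norm $\|T\|_L=\sup_{x\ne y}\|Tx-Ty\|/\|x-y\|$; $D(z)=\{z^*\in Z^*: z^*(z)=\|z^*\|\|z\|=\|z\|^2\}$; $\nu_L(T)=\sup\left\{\frac{|z^*(Tx-Ty)|}{\|x-y\|^2}: x\ne y \text{ in } Z,\ z^*\in D(x-y)\right\}$; and $n_L(Z)=\inf\{\nu_L(T): T\in\mathrm{Lip}_0(Z,Z),\ \|T\|_L=1\}$. *)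

(* Defs.v *)
From HB Require Import structures.
From mathcomp Require Import all_boot all_order all_algebra.
From mathcomp Require Import complex.
From mathcomp Require Import boolp classical_sets functions reals topology.
From mathcomp Require Import tvs normedtype.

Set Implicit Arguments.
Unset Strict Implicit.
Unset Printing Implicit Defensive.

Import Order.TTheory GRing.Theory Num.Theory.
Import numFieldNormedType.Exports.

Local Open Scope classical_set_scope.
Local Open Scope ring_scope.
Local Open Scope complex_scope.

(* In a normed module over R[i] the norm `|x| is a nonnegative element of R[i]
   with zero imaginary part; rnorm x is the same number, as a real. *)
Definition rnorm (R : realType) (V : normedModType R[i]) (x : V) : R :=
  complex.Re `|x|.

Section rnormE.
Variables (R : realType) (V : normedModType R[i]).

Lemma rnormE (x : V) : (rnorm x)%:C = `|x|.
Proof. by rewrite RRe_real// normr_real. Qed.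

End rnormE.

Section rnorm_theory.
Variables (R : realType) (V : normedModType R[i]).
Implicit Types x y : V.

Lemma rnorm_ge0 x : 0 <= rnorm x.
Proof. by rewrite -ler0c rnormE. Qed.

Lemma rnorm_distC x y : rnorm (x - y) = rnorm (y - x).
Proof. by rewrite /rnorm distrC. Qed.

Lemma ler_rnormD x y : rnorm (x + y) <= rnorm x + rnorm y.
Proof. by rewrite -lecR rmorphD/= !rnormE ler_normD. Qed.

Lemma rnormZ (a : R[i]) x : rnorm (a *: x) = rnorm (a : R[i]^o) * rnorm x.
Proof.
have/(congr1 (@complex.Re R)) := normrZ a x.
by rewrite -(rnormE x) -(rnormE (a : R[i]^o)) -rmorphM.
Qed.

Lemma rnorm_eq0 x : rnorm x = 0 -> x = 0.
Proof. by move=> x0; apply/normr0_eq0; rewrite -rnormE x0. Qed.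

Lemma rnorm_continuous : continuous (@rnorm R V).
Proof.
move=> x; apply/cvgrPdist_lt => e e0.
have eC0 : 0 < e%:C :> R[i] by rewrite -[0]/((0 : R)%:C) ltcR.
near=> y; have lt_xy : rnorm (x - y) < e.
  rewrite -ltcR rnormE; near: y.
  by apply: cvgr_dist_lt.
apply: le_lt_trans lt_xy; rewrite ler_norml lerBlDr lerNl opprB lerBlDr.
have h (u v : V) : rnorm u <= rnorm (u - v) + rnorm v.
  by have := ler_rnormD (u - v) v; rewrite subrK.
by rewrite h andbT rnorm_distC h.
Unshelve. all: by end_near. Qed.

End rnorm_theory.

(* C(K, X). Compactness of K is a parameter of the type because the supremum
   norm, attached below as a canonical structure, is finite only for compact K. *)
Definition Cspace (R : realType) (K : topologicalType)
    (cK : compact [set: K]) (X : normedModType R[i]) : Type :=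
  continuousType K X.

Section Cspace.
Variables (R : realType) (K : topologicalType) (cK : compact [set: K]).
Variable X : normedModType R[i].
Local Notation CKX := (Cspace cK X).
Implicit Types f g : CKX.

HB.instance Definition _ := Choice.on CKX.

Definition Cmk (f : K -> X) (cf : continuous f) : CKX := mkcts cf.

Lemma Cspace_eqP f g : f =1 g -> f = g.
Proof. by move=> fg; apply/continuousEP. Qed.

Definition Czero : CKX := Cmk ((fun t => @cst_continuous K X 0 t)).

Lemma Cadd_continuous f g : continuous (fun t => f t + g t).
Proof. by move=> t; apply: cvgD; exact: cts_fun. Qed.

Lemma Copp_continuous f : continuous (fun t => - f t).
Proof. by move=> t; apply: cvgN; exact: cts_fun. Qed.

Lemma Cscale_continuous (a : R[i]) f : continuous (fun t => a *: f t).
Proof. by move=> t; apply: cvgZr; exact: cts_fun. Qed.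

Definition Cadd f g := Cmk (@Cadd_continuous f g).
Definition Copp f := Cmk (@Copp_continuous f).
Definition Cscale (a : R[i]) f := Cmk (@Cscale_continuous a f).

Fact Cadd_A : associative Cadd.
Proof. by move=> f g h; apply: Cspace_eqP => t; exact: addrA. Qed.
Fact Cadd_C : commutative Cadd.
Proof. by move=> f g; apply: Cspace_eqP => t; exact: addrC. Qed.
Fact Cadd_0 : left_id Czero Cadd.
Proof. by move=> f; apply: Cspace_eqP => t; exact: add0r. Qed.
Fact Cadd_N : left_inverse Czero Copp Cadd.
Proof. by move=> f; apply: Cspace_eqP => t; exact: addNr. Qed.

HB.instance Definition _ :=
  GRing.isZmodule.Build CKX Cadd_A Cadd_C Cadd_0 Cadd_N.

Fact Cscale_A a b f : Cscale a (Cscale b f) = Cscale (a * b) f.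
Proof. by apply: Cspace_eqP => t; exact: scalerA. Qed.
Fact Cscale_1 : left_id 1 Cscale.
Proof. by move=> f; apply: Cspace_eqP => t; exact: scale1r. Qed.
Fact Cscale_Dr : right_distributive Cscale +%R.
Proof. by move=> a f g; apply: Cspace_eqP => t; exact: scalerDr. Qed.
Fact Cscale_Dl f : {morph Cscale^~ f : a b / a + b}.
Proof. by move=> a b; apply: Cspace_eqP => t; exact: scalerDl. Qed.

HB.instance Definition _ :=
  GRing.Zmodule_isLmodule.Build R[i] CKX Cscale_A Cscale_1 Cscale_Dr Cscale_Dl.

Definition supnorm f : R := sup (range (fun t => rnorm (f t))).

Lemma supnorm_ubound f : has_ubound (range (fun t => rnorm (f t))).
Proof.
have cf : continuous (fun t => rnorm (f t)).
  by move=> t; apply: continuous_comp; [exact: cts_fun|exact: rnorm_continuous].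
have /compact_bounded[M [Mr /(_ (M + 1))]] :=
  continuous_compact (continuous_subspaceT cf) cK.
rewrite ltrDl ltr01 => /(_ isT) H; exists (M + 1) => _ [t _ <-].
by apply: le_trans (ler_norm _) _; apply: H; exists t.
Qed.

Lemma supnorm_ge f t : rnorm (f t) <= supnorm f.
Proof. by apply: (ub_le_sup (supnorm_ubound f)); exists t. Qed.

Lemma supnorm_le f (M : R) :
  0 <= M -> (forall t, rnorm (f t) <= M) -> supnorm f <= M.
Proof.
move=> M0 fM; have [S0|/set0P S0] := eqVneq (range (fun t => rnorm (f t))) set0.
  by rewrite /supnorm S0 sup0.
by apply: ge_sup => // _ [t _ <-].
Qed.

Lemma supnorm_ge0 f : 0 <= supnorm f.
Proof.
have [S0|/set0P[_ [t _ _]]] := eqVneq (range (fun t => rnorm (f t))) set0.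
  by rewrite /supnorm S0 sup0.
exact: le_trans (rnorm_ge0 _) (supnorm_ge f t).
Qed.

Fact supnormD f g : (supnorm (f + g))%:C <= (supnorm f)%:C + (supnorm g)%:C.
Proof.
rewrite -rmorphD lecR/=; apply: supnorm_le => [|t].
  by rewrite addr_ge0 ?supnorm_ge0.
by apply: le_trans (ler_rnormD _ _) _; rewrite lerD ?supnorm_ge.
Qed.

Let supnormZ_le (a : R[i]) f :
  supnorm (a *: f) <= rnorm (a : R[i]^o) * supnorm f.
Proof.
apply: supnorm_le => [|t]; first by rewrite mulr_ge0 ?rnorm_ge0 ?supnorm_ge0.
by rewrite [X in X <= _]rnormZ ler_wpM2l ?rnorm_ge0 ?supnorm_ge.
Qed.

Fact supnormZ (a : R[i]) f : (supnorm (a *: f))%:C = `|a| * (supnorm f)%:C.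
Proof.
rewrite -[`|a|]/(`|a : R[i]^o|) -rnormE -rmorphM; congr (_%:C).
apply/eqP; rewrite eq_le supnormZ_le/=.
have [->|a0] := eqVneq a 0.
  by rewrite /rnorm normr0 mul0r supnorm_ge0.
have na0 : 0 < rnorm (a : R[i]^o).
  rewrite lt_neqAle rnorm_ge0 andbT eq_sym; apply/eqP => /rnorm_eq0 /eqP.
  exact/negP.
rewrite mulrC -ler_pdivlMr//; apply: le_trans (_ : supnorm (a^-1 *: (a *: f)) <= _).
  by rewrite scalerA mulVf// scale1r.
apply: le_trans (supnormZ_le _ _) _; rewrite mulrC ler_wpM2l ?supnorm_ge0//.
rewrite -lecR fmorphV/= !rnormE.
by rewrite normfV.
Qed.

Fact supnorm0_eq0 f : (supnorm f)%:C = 0 -> f = 0.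
Proof.
move=> /complexI f0; apply: Cspace_eqP => t; apply: rnorm_eq0; apply/eqP.
by rewrite eq_le rnorm_ge0 andbT -f0 supnorm_ge.
Qed.

HB.instance Definition _ :=
  Lmodule_isNormed.Build R[i] CKX supnormD supnormZ supnorm0_eq0.

End Cspace.

(* A linear subspace S of V as a space of its own, with the norm inherited
   from V; its dual and its Lipschitz self-maps are those of S, not of V. *)
Definition subspace_type (R : realType) (V : normedModType R[i])
  (S : submodClosed V) : Type := {x : V | x \in S}.

Section subspace_type.
Variables (R : realType) (V : normedModType R[i]) (S : submodClosed V).
Local Notation W := (subspace_type S).

HB.instance Definition _ := [isSub of W for @sval V (fun x => x \in S)].
HB.instance Definition _ := [Choice of W by <:].
HB.instance Definition _ := [SubChoice_isSubLmodule of W by <:].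

Definition subnorm (x : W) : R[i] := `|val x|.

Fact subnormD x y : subnorm (x + y) <= subnorm x + subnorm y.
Proof. by rewrite /subnorm raddfD ler_normD. Qed.
Fact subnormZ (a : R[i]) x : subnorm (a *: x) = `|a| * subnorm x.
Proof. by rewrite /subnorm linearZ/= normrZ. Qed.
Fact subnorm0_eq0 x : subnorm x = 0 -> x = 0.
Proof. by move=> /normr0_eq0 x0; apply: val_inj; rewrite x0 raddf0. Qed.

HB.instance Definition _ :=
  Lmodule_isNormed.Build R[i] W subnormD subnormZ subnorm0_eq0.

End subspace_type.

#[short(type="dualType")]
HB.structure Definition Dual (R : realType) (Z : normedModType R[i]) :=
  {f of @GRing.Linear R[i] Z R[i]^o *:%R f & @Continuous Z R[i]^o f}.

(* sup and inf below are the real-valued ones, equal to 0 on an empty or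
   unbounded set. This matters only for Z = 0 or for maps that are not Lipschitz:
   when Z is nonzero and T is in Lip0, all the sets involved are nonempty and
   bounded. *)
Section numerical_index.
Variables (R : realType) (Z : normedModType R[i]).

Definition dualnorm (z' : dualType Z) : R :=
  sup [set rnorm (z' x) | x in [set x : Z | rnorm x <= 1]].

Definition duality_map (z : Z) : set (dualType Z) :=
  [set z' : dualType Z | z' z = (dualnorm z' * rnorm z)%:C /\
                         dualnorm z' * rnorm z = rnorm z ^+ 2].

Definition Lip0 : set (Z -> Z) := [set T | lipschitz T /\ T 0 = 0].

Definition Lnorm (T : Z -> Z) : R :=
  sup [set r | exists x y : Z, x <> y /\
    r = rnorm (T x - T y) / rnorm (x - y)].

Definition nuL (T : Z -> Z) : R :=
  sup [set r | exists (x y : Z) (z' : dualType Z),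
    [/\ x <> y, duality_map (x - y) z' &
        r = rnorm (z' (T x - T y)) / rnorm (x - y) ^+ 2]].

Definition nL : R := inf [set nuL T | T in [set T | Lip0 T /\ Lnorm T = 1]].

End numerical_index.

Section AKX.
Variables (R : realType) (K : topologicalType) (cK : compact [set: K]).
Local Notation CK := (Cspace cK R[i]^o).

Section product.
Variable X : normedModType R[i].

Lemma Ctens_continuous (phi : CK) (x : X) : continuous (fun t => phi t *: x).
Proof. by move=> t; apply: cvgZr_tmp; exact: cts_fun. Qed.

Definition Ctens (phi : CK) (x : X) : Cspace cK X :=
  Cmk cK (@Ctens_continuous phi x).

Lemma Cmul_continuous (f : CK) (g : Cspace cK X) :
  continuous (fun t => f t *: g t).
Proof. by move=> t; apply: cvgZ; exact: cts_fun. Qed.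

(* For X = R[i]^o this is the pointwise product of C(K). *)
Definition Cmul (f : CK) (g : Cspace cK X) : Cspace cK X :=
  Cmk cK (@Cmul_continuous f g).

End product.

Definition uniform_algebra (A : set CK) : Prop :=
  [/\ closed A,
      (forall (a : R[i]) f g, A f -> A g -> A (a *: f + g)),
      (forall f g, A f -> A g -> A (Cmul f g)),
      (forall c : R[i], A (Cmk cK (@cst_continuous K R[i]^o c))) &
      (forall s t : K, s <> t -> exists2 f : CK, A f & f s <> f t)].

Variable X : normedModType R[i].

Lemma dual_comp_continuous (x' : dualType X) (f : Cspace cK X) :
  continuous (x' \o f).
Proof. exact: cts_fun. Qed.

Definition dual_comp (x' : dualType X) (f : Cspace cK X) : CK :=
  Cmk cK (@dual_comp_continuous x' f).

Definition base_algebra (S : set (Cspace cK X)) : set CK :=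
  [set h | exists2 f, S f & exists x' : dualType X, h = dual_comp x' f].

Definition is_AKX (S : submodClosed (Cspace cK X)) : Prop :=
  let A := base_algebra [set` S] in
  [/\ closed [set` S],
      uniform_algebra A,
      (forall phi x, A phi -> Ctens phi x \in S) &
      (forall f g, A f -> g \in S -> Cmul f g \in S)].

Lemma Lip0_continuous (T : X -> X) : Lip0 T -> continuous T.
Proof.
move=> [/pinfty_ex_gt0[M M0 MT] _] x; apply/cvgrPdist_lt => e e0.
have eM0 : 0 < e / M by rewrite divr_gt0.
near=> y; apply: le_lt_trans (MT (x, y) (conj I I)) _ => /=.
by rewrite mulrC -ltr_pdivlMr.
Unshelve. all: by end_near. Qed.

Lemma QS_continuous (T : X -> X) (lT : Lip0 T) (f : Cspace cK X) :
  continuous (T \o f).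
Proof.
move=> t; apply: continuous_comp; first exact: cts_fun.
exact: Lip0_continuous.
Qed.

Definition QS (S : submodClosed (Cspace cK X)) (T : X -> X) (lT : Lip0 T)
    (f : subspace_type S) : Cspace cK X :=
  Cmk cK (@QS_continuous T lT (val f)).

End AKX.

(* Main.v *)
Require Import Defs.
From mathcomp Require Import all_boot all_order all_algebra.
From mathcomp Require Import complex finmap.
From mathcomp Require Import boolp classical_sets functions reals topology.
From mathcomp Require Import tvs normedtype derive.
From mathcomp Require Import ring lra.
From HB Require Import structures.

(* Both inequalities rest on one perturbation estimate. If [S] is Lipschitz and
   [u := S x - S y], testing duality at [x - y + a l u] rather than at [x - y] gives
     |x - y + a l u| <= (1 + O(a^2)) / (1 - a nuL S) * |x - y|   for [|l| = 1],
   since [S x - S (y - a l u)] is within [O(a)|x - y|] of [u]. Such norm estimates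
   can be checked pointwise and imply [|z' u| <= (nuL S + O(a)) |x - y|^2], even when
   [z'] norms [x - y] only up to [O(a^2)].

   Applied to [Q_S] this gives [nuL Q_S <= nuL S], hence [nL (A(K,X)) <= nL X].

   Conversely let [T] have Lipschitz norm 1 on [A(K,X)], almost attained at [f, g].
   There are [t0] and [phi] in the base algebra such that [phi t0 = 1],
   [|phi| + |1 - phi| <= 1 + e] everywhere, [f - g] is nearly constant where [phi] is
   not small, and [T f - T g] is almost norm-attaining at [t0]. The maps
     x |-> h + (u' x) (1 - phi) (f - g) / |f - g| + phi x
   are then almost isometric from [X] to [A(K,X)], and transport [T] to a Lipschitz map
   of [X] of norm close to 1 and numerical radius at most [nuL T + O(a)].

   As only almost-isometries are needed, boundary theory for uniform algebras and
   Riemann maps are avoided: instead of a strong boundary point one shrinks, finitely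
   many times, a set off which some function of the algebra is smaller than its norm,
   and [phi] is an explicit polynomial in such a function. *)

Set Implicit Arguments.
Unset Strict Implicit.
Unset Printing Implicit Defensive.

Import Order.TTheory GRing.Theory Num.Theory.
Import numFieldNormedType.Exports.

Local Open Scope classical_set_scope.
Local Open Scope ring_scope.
Local Open Scope complex_scope.

(** * Calculus of the real-valued norm *)

Section rnorm_facts.
Variables (R : realType) (V : normedModType R[i]).
Implicit Types (x y : V) (a : R[i]) (r : R).

Lemma rnorm0 : rnorm (0 : V) = 0.
Proof. by rewrite /rnorm normr0. Qed.

Lemma rnormN x : rnorm (- x) = rnorm x.
Proof. by rewrite /rnorm normrN. Qed.

Lemma rnorm_gt0 x : (0 < rnorm x) = (x != 0).
Proof.
rewrite lt_def rnorm_ge0 andbT; congr (~~ _).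
by apply/eqP/eqP => [/rnorm_eq0//|->]; rewrite rnorm0.
Qed.

Lemma ler_rnormB x y : rnorm x - rnorm y <= rnorm (x - y).
Proof. by rewrite lerBlDr; have := ler_rnormD (x - y) y; rewrite subrK. Qed.

End rnorm_facts.

Section rnorm_complex.
Variable R : realType.

Lemma rnorm_real (r : R) : rnorm (r%:C : R[i]^o) = `|r|.
Proof. by rewrite /rnorm [ `|_| ]normc_def/= expr0n/= addr0 sqrtr_sqr. Qed.

Lemma rnormM (a b : R[i]) :
  rnorm (a * b : R[i]^o) = rnorm (a : R[i]^o) * rnorm (b : R[i]^o).
Proof. exact: rnormZ. Qed.

Lemma rnormX (a : R[i]) n : rnorm (a ^+ n : R[i]^o) = rnorm (a : R[i]^o) ^+ n.
Proof.
elim: n => [|n IH]; first by rewrite !expr0 (rnorm_real 1) normr1.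
by rewrite !exprS rnormM IH.
Qed.

Lemma rnorm1 : rnorm (1 : R[i]^o) = 1.
Proof. by rewrite (rnorm_real 1) normr1. Qed.

Lemma rnormV (a : R[i]) : rnorm (a^-1 : R[i]^o) = (rnorm (a : R[i]^o))^-1.
Proof.
have [->|a0] := eqVneq a 0; first by rewrite invr0 rnorm0 invr0.
have na0 : rnorm (a : R[i]^o) != 0 by rewrite gt_eqF// rnorm_gt0.
by apply: (mulfI na0); rewrite -rnormM !divff// rnorm1.
Qed.

Lemma rnorm_sqr (a : R[i]) :
  rnorm (a : R[i]^o) ^+ 2 = complex.Re a ^+ 2 + complex.Im a ^+ 2.
Proof. by rewrite /rnorm [ `|a| ]normc_def/= sqr_sqrtr// addr_ge0 ?sqr_ge0. Qed.

Lemma rnorm_parallelogram (a : R[i]) (r : R) :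
  rnorm (a - r%:C : R[i]^o) ^+ 2 + rnorm (a + r%:C : R[i]^o) ^+ 2 =
  2 * rnorm (a : R[i]^o) ^+ 2 + 2 * r ^+ 2.
Proof. by rewrite !rnorm_sqr; case: a => x y /=; ring. Qed.

Lemma rnorm_phase (a : R[i]) :
  exists2 l : R[i], rnorm (l : R[i]^o) = 1 & l * a = (rnorm (a : R[i]^o))%:C.
Proof.
have [->|a0] := eqVneq a 0.
  by exists 1; [exact: rnorm1|rewrite mulr0 rnorm0].
have na0 : rnorm (a : R[i]^o) != 0 by rewrite gt_eqF// rnorm_gt0.
exists ((rnorm (a : R[i]^o))%:C / a); last by rewrite divfK.
apply: (mulIf na0); rewrite -rnormM divfK// rnorm_real mul1r.
by rewrite ger0_norm ?rnorm_ge0.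
Qed.

Lemma rnormZr (V : normedModType R[i]) (r : R) (x : V) :
  rnorm (r%:C *: x) = `|r| * rnorm x.
Proof. by rewrite rnormZ rnorm_real. Qed.

End rnorm_complex.

(** * The Hahn-Banach theorem *)

Section hahn_banach.
Variables (R : realType) (V : normedModType R[i]).
Implicit Types (x y w : V) (G : set (V * R)).

Definition real_linear_graph G :=
  forall (r : R) x a y b, G (x, a) -> G (y, b) -> G (r%:C *: x + y, r * a + b).

(** Scaling reduces the cases [s < 0] and [0 < s] to [a - |x - v| <= c <= |y + v| - b] over all
    points of the graph. The triangle inequality makes these constraints compatible, and [c] is the
    supremum of the left-hand sides. *)
Lemma extend_real_linear_graph G (v : V) :
    G (0, 0) -> real_linear_graph G ->
    (forall x a, G (x, a) -> a <= rnorm x) ->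
  exists c, forall x a s, G (x, a) -> a + s * c <= rnorm (x + s%:C *: v).
Proof.
move=> G0 Gl Gn; pose E := [set r | exists x a, G (x, a) /\ r = a - rnorm (x - v)].
have E0 : E !=set0 by exists (0 - rnorm (0 - v)); exists 0, 0.
have ubE y b : G (y, b) -> ubound E (rnorm (y + v) - b).
  move=> Gy _ [x [a [Gx ->]]]; rewrite lerBlDr addrAC lerBrDr.
  have := Gn _ _ (Gl 1 _ _ _ _ Gx Gy); rewrite scale1r mul1r => /le_trans; apply.
  by apply: le_trans (ler_rnormD _ _); rewrite addrACA subrr addr0 addrC.
have lE x a : G (x, a) -> a - rnorm (x - v) <= sup E.
  move=> Gx; apply: (ub_le_sup _); last by exists x, a.
  by exists (rnorm (0 + v) - 0); exact: ubE.
have uE y b : G (y, b) -> sup E <= rnorm (y + v) - b.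
  by move=> Gy; apply: ge_sup => //; exact: ubE.
have Gz (r : R) x a : G (x, a) -> G (r%:C *: x, r * a).
  by move=> Gx; have := Gl r _ _ _ _ Gx G0; rewrite !addr0.
exists (sup E) => x a s Gx.
have [s0|s0|<-] := ltgtP 0 s; last first.
- by rewrite mul0r addr0 scale0r addr0; exact: Gn.
- have ns0 : 0 < - s by rewrite oppr_gt0.
  have -> : x + s%:C *: v = (- s)%:C *: ((- s)^-1%:C *: x - v).
    rewrite scalerBr scalerA -rmorphM/= divff ?gt_eqF// scale1r.
    by rewrite rmorphN/= scaleNr opprK.
  have -> : a + s * sup E = - s * ((- s)^-1 * a - sup E).
    by rewrite mulrBr mulVKf ?lt0r_neq0// mulNr opprK.
  rewrite rnormZr gtr0_norm// ler_pM2l// lerBlDr addrC -lerBlDr.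
  exact: lE (Gz _ _ _ Gx).
- have -> : x + s%:C *: v = s%:C *: (s^-1%:C *: x + v).
    by rewrite scalerDr scalerA -rmorphM/= divff ?gt_eqF// scale1r.
  rewrite rnormZr gtr0_norm// -{1}[a](mulVKf (lt0r_neq0 s0)) -mulrDr ler_pM2l//.
  rewrite addrC -lerBrDr; exact: uE (Gz _ _ _ Gx).
Qed.

(* Zorn is applied to the graphs dominated by the norm even after adding the
   multiples of [(w, rnorm w)]; a maximal one then contains [(w, rnorm w)]. *)
Lemma real_hahn_banach w : exists f : V -> R,
  [/\ forall (r : R) x y, f (r%:C *: x + y) = r * f x + f y,
      forall x, f x <= rnorm x & f w = rnorm w].
Proof.
pose P G := real_linear_graph G /\
  forall x a r, G (x, a) -> a + r * rnorm w <= rnorm (x + r%:C *: w).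
have [F FP Ftot|G [[Gl Gw] Gmax]] := @Zorn_bigcup (V * R)%type P.
  split=> [r x a y b [G1 FG1 Gx] [G2 FG2 Gy]|x a r [G FG]]; last exact: (FP _ FG).2.
  have [/(_ _ Gx) Gx2|/(_ _ Gy) Gy1] := Ftot _ _ FG1 FG2.
    by exists G2 => //; exact: (FP _ FG2).1.
  by exists G1 => //; exact: (FP _ FG1).1.
pose extG G v c := [set p : V * R | exists x a s,
  [/\ G (x, a), p.1 = x + s%:C *: v & p.2 = a + s * c]].
have extGl v c : real_linear_graph (extG G v c).
  move=> r _ _ _ _ [x [a [s [Gx /= -> ->]]]] [y [b [t [Gy /= -> ->]]]].
  exists (r%:C *: x + y), (r * a + b), (r * s + t); split; first exact: Gl.
    by rewrite scalerDr scalerA rmorphD rmorphM/= scalerDl addrACA.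
  by rewrite mulrDr mulrDl addrACA mulrA.
have extmax v c : (forall x a r, extG G v c (x, a) ->
    a + r * rnorm w <= rnorm (x + r%:C *: w)) -> G (0, 0) -> G (v, c).
  move=> domG G0; apply: contrapT => nG; apply: (Gmax (extG G v c)); last by split.
  split=> [|/(_ (v, c)) sG]; last first.
    apply/nG/sG; exists 0, 0, 1; split=> //=; first by rewrite scale1r add0r.
    by rewrite mul1r add0r.
  by move=> [x a] Gx; exists x, a, 0; rewrite scale0r mul0r !addr0.
(* [P] admits the empty graph, the union of the empty chain. A nonempty linear graph contains
   [(0, 0)], so if [G] missed this point it would be empty and could be enlarged by it. *)
have G0 : G (0, 0).
  apply: contrapT => nG; apply: (Gmax (G `|` [set (0, 0)])).
    split=> [p|/(_ (0, 0))]; first by left.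
    by move=> GG; apply/nG/GG; right.
  have G00 z : (G `|` [set (0, 0)]) z -> z = (0, 0).
    case=> //; case: z => x a Gx; exfalso; apply: nG.
    have := Gl 0 _ _ _ _ Gx Gx; have := Gl (-1) _ _ _ _ Gx Gx.
    by rewrite rmorphN scaleN1r addNr mulN1r addNr.
  split=> [r x a y b /G00[-> ->] /G00[-> ->]|x a r /G00[-> ->]].
    by right; rewrite scaler0 mulr0 !addr0.
  by rewrite !add0r rnormZr ler_wpM2r ?rnorm_ge0 ?ler_norm.
have Gww : G (w, rnorm w).
  apply: extmax => // _ _ r [x [a [s [Gx /= -> ->]]]].
  by rewrite -!addrA -mulrDl -scalerDl -rmorphD; exact: Gw.
have Gn x a : G (x, a) -> a <= rnorm x.
  by move=> Gx; have := Gw _ _ 0 Gx; rewrite mul0r scale0r !addr0.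
(* Since [(w, rnorm w)] is now in [G], its multiples are absorbed by [G], and domination by the norm
   alone is enough to extend. *)
have Gtot v : exists c, G (v, c).
  have [c Hc] := extend_real_linear_graph v G0 Gl Gn; exists c.
  apply: extmax => // _ _ r [x [a [s [Gx /= -> ->]]]].
  rewrite addrAC [x + _ + _]addrAC; apply: Hc.
  by have := Gl r _ _ _ _ Gww Gx; rewrite addrC [r * _ + _]addrC.
have Gle x a b : G (x, a) -> G (x, b) -> b <= a.
  move=> Ga Gb; have := Gn _ _ (Gl (-1) _ _ _ _ Ga Gb).
  by rewrite rmorphN scaleN1r addNr rnorm0 mulN1r addrC subr_le0.
have Gfun x a b : G (x, a) -> G (x, b) -> a = b.
  by move=> Ga Gb; apply/eqP; rewrite eq_le !(Gle x).
have [f Gf] := choice Gtot; exists f; split=> [r x y|x|].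
- by apply: Gfun (Gl _ _ _ _ _ (Gf x) (Gf y)); exact: Gf.
- exact: Gn.
- exact: Gfun (Gf w) Gww.
Qed.

Lemma dual_of_bounded (f : V -> R[i]^o) (M : R) :
    (forall a x y, f (a *: x + y) = a * f x + f y) ->
    (forall x, rnorm (f x) <= M * rnorm x) ->
  exists z' : dualType V, z' =1 f.
Proof.
move=> fl fM; have fB x y : f x - f y = f (x - y).
  by rewrite [x - y]addrC -[- y]scaleN1r fl mulN1r addrC.
have cf : continuous f.
  move=> x; apply/cvgrPdist_lt => e e0.
  have e0R : 0 < complex.Re e by move: e0; rewrite ltcE => /andP[].
  have eE : e = (complex.Re e)%:C by rewrite RRe_real// gtr0_real.
  have M0 : 0 < `|M| + 1 by rewrite ltr_pwDr.
  have eM0 : 0 < ((complex.Re e) / (`|M| + 1))%:C :> R[i] by rewrite ltcR divr_gt0.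
  near=> y; rewrite fB -rnormE eE ltcR; apply: le_lt_trans (fM _) _.
  apply: (@le_lt_trans _ _ ((`|M| + 1) * rnorm (x - y))).
    by rewrite ler_wpM2r ?rnorm_ge0// ler_wpDr// ler_norm.
  rewrite mulrC -ltr_pdivlMr// -ltcR rnormE; near: y.
  exact: cvgr_dist_lt.
by exists (HB.pack_for (dualType V) f (GRing.isLinear.Build R[i] V R[i]^o *:%R f fl)
                     (isContinuous.Build V R[i]^o f cf)).
Unshelve. all: by end_near. Qed.

End hahn_banach.

(** * Norming functionals and the duality map *)

Section duality.
Variables (R : realType) (V : normedModType R[i]).
Implicit Types (x y z w : V).

Lemma dual_bounded (z' : dualType V) : exists2 M, 0 <= M & forall x, rnorm (z' x) <= M * rnorm x.
Proof.
have /cvgrPdist_lt/(_ 1 ltr01) : z' y @[y --> 0] --> z' 0 by exact: cts_fun.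
rewrite linear0 => /nbhs_normP[e /= e0 ze].
have e0R : 0 < complex.Re e by move: e0; rewrite ltcE => /andP[].
have eE : e = (complex.Re e)%:C by rewrite RRe_real// gtr0_real.
exists (2 / complex.Re e) => [|x]; first by rewrite divr_ge0// ltW.
have [->|x0] := eqVneq x 0; first by rewrite linear0 !rnorm0 mulr0.
have nx0 : 0 < rnorm x by rewrite rnorm_gt0.
pose r := complex.Re e / 2 / rnorm x.
have r0 : 0 < r by rewrite !divr_gt0.
have : rnorm (z' (r%:C *: x)) <= 1.
  rewrite -lecR rnormE -normrN -[- _]add0r; apply/ltW/ze.
  rewrite /= sub0r normrN -rnormE eE ltcR rnormZr gtr0_norm// divfK ?gt_eqF//.
  by rewrite ltr_pdivrMr// ltr_pMr// ltr1n.
rewrite linearZ/= rnormZr gtr0_norm// -ler_pdivlMl// => /le_trans; apply.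
by rewrite mulr1 /r invf_div invf_div mulrC.
Qed.

Lemma dualnorm_ubound (z' : dualType V) :
  has_ubound [set rnorm (z' x) | x in [set x : V | rnorm x <= 1]].
Proof.
have [M M0 zM] := dual_bounded z'; exists M => _ [x /= x1 <-].
by apply: le_trans (zM x) _; rewrite ler_piMr.
Qed.

Lemma dualnorm_ge (z' : dualType V) x : rnorm (z' x) <= dualnorm z' * rnorm x.
Proof.
have [->|x0] := eqVneq x 0; first by rewrite linear0 !rnorm0 mulr0.
have nx0 : 0 < rnorm x by rewrite rnorm_gt0.
rewrite -ler_pdivrMr//; apply: ub_le_sup (dualnorm_ubound z') _ _.
exists ((rnorm x)^-1%:C *: x) => /=.
  by rewrite rnormZr ger0_norm ?invr_ge0 ?rnorm_ge0// mulVf ?gt_eqF.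
by rewrite linearZ/= rnormZr ger0_norm ?invr_ge0 ?rnorm_ge0// mulrC.
Qed.

Lemma dualnorm_le (z' : dualType V) M :
  0 <= M -> (forall x, rnorm (z' x) <= M * rnorm x) -> dualnorm z' <= M.
Proof.
move=> M0 zM; apply: ge_sup => [|_ [x /= x1 <-]].
  by exists (rnorm (z' 0)), 0 => //=; rewrite rnorm0 ler01.
by apply: le_trans (zM x) _; rewrite ler_piMr.
Qed.

(** Dividing by [rnorm z] forces [dualnorm z' = rnorm z], so a pointwise bound can replace the
    supremum in [dualnorm]. *)
Lemma duality_mapP z (z' : dualType V) : z != 0 ->
  duality_map z z' <->
  z' z = (rnorm z ^+ 2)%:C /\ forall x, rnorm (z' x) <= rnorm z * rnorm x.
Proof.
move=> z0; have nz0 : 0 < rnorm z by rewrite rnorm_gt0.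
split=> [[zz]|[zz zn]].
  rewrite expr2 => dz; rewrite zz dz; split=> // x.
  by rewrite -(mulIf _ dz) ?gt_eqF//; exact: dualnorm_ge.
have dz : dualnorm z' = rnorm z.
  apply/eqP; rewrite eq_le dualnorm_le ?rnorm_ge0//= -(ler_pM2r nz0).
  apply: le_trans (dualnorm_ge z' z); rewrite zz rnorm_real ger0_norm ?sqr_ge0//.
by split; rewrite dz -expr2.
Qed.

Lemma hahn_banach_norming z : exists2 z' : dualType V,
  z' z = (rnorm z)%:C & forall x, rnorm (z' x) <= rnorm x.
Proof.
have [f [fl fn fz]] := real_hahn_banach z.
have fD x y : f (x + y) = f x + f y by have := fl 1 x y; rewrite scale1r mul1r.
have f0 : f 0 = 0 by apply: (addIr (f 0)); rewrite -fD !add0r.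
have fZ r x : f (r%:C *: x) = r * f x by have := fl r x 0; rewrite f0 !addr0.
have fN x : f (- x) = - f x by have := fZ (-1) x; rewrite rmorphN scaleN1r mulN1r.
(* The complex-linear functional with real part [f]. *)
pose g x : R[i] := f x +i* - f ('i *: x).
have gl a x y : g (a *: x + y) = a * g x + g y.
  have aE (c : R[i]) v : f (c *: v) = complex.Re c * f v + complex.Im c * f ('i *: v).
    by rewrite {1}[c]complexE mulrC scalerDl -scalerA fD !fZ.
  rewrite /g scalerDr !fD scalerA (aE a x) (aE ('i%C * a) x).
  by case: a => a b /=; apply/eqP; rewrite eq_complex/=; apply/andP; split;
    apply/eqP; ring.
(* Multiplying [x] by a phase makes [g] real, hence equal to [f] there, and leaves the norm of [x]
   unchanged. *)
have gn x : rnorm (g x : R[i]^o) <= rnorm x.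
  have [l l1 lg] := rnorm_phase (g x).
  have g0 : g 0 = 0 by rewrite /g scaler0 f0 oppr0.
  have : g (l *: x) = l * g x by rewrite -[l *: x]addr0 gl g0 addr0.
  rewrite lg => /(congr1 (@complex.Re R)) /= <-.
  by apply: le_trans (fn _) _; rewrite rnormZ l1 mul1r.
have gz : g z = (rnorm z)%:C.
  have := gn z; rewrite -ler_sqr ?nnegrE ?rnorm_ge0// rnorm_sqr/= fz.
  rewrite gerDl => Im0; congr (_ +i* _); first exact: fz.
  by apply/eqP; rewrite -sqrf_eq0 eq_le Im0 sqr_ge0.
have [|x|z' z'E] := @dual_of_bounded _ _ g 1; [exact: gl|by rewrite mul1r|].
by exists z' => [|x]; rewrite z'E.
Qed.

Lemma hahn_banach_duality z : z != 0 -> exists z' : dualType V, duality_map z z'.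
Proof.
move=> z0; have [f fz fn] := hahn_banach_norming z.
have [|x|z' z'E] := @dual_of_bounded _ _ (fun x => (rnorm z)%:C * f x) (rnorm z).
- by move=> a x y; rewrite linearP mulrDr mulrCA.
- by rewrite rnormM rnorm_real ger0_norm ?rnorm_ge0// ler_wpM2l ?rnorm_ge0.
exists z'; apply/duality_mapP => //; split=> [|x]; rewrite z'E.
  by rewrite fz -rmorphM.
by rewrite rnormM rnorm_real ger0_norm ?rnorm_ge0// ler_wpM2l ?rnorm_ge0.
Qed.

End duality.

(** * Lipschitz numerical radius *)

Section lipschitz_index.
Variables (R : realType) (Z : normedModType R[i]).
Implicit Types (T : Z -> Z) (x y z : Z) (M : R).

Lemma Lip0P T : Lip0 T <->
  (exists2 M, 0 <= M & forall x y, rnorm (T x - T y) <= M * rnorm (x - y)) /\ T 0 = 0.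
Proof.
split=> -[TL T0]; split=> //.
  have [M M0 TM] := pinfty_ex_gt0 TL.
  have ME : M = (complex.Re M)%:C by rewrite RRe_real// gtr0_real.
  exists (complex.Re M) => [|x y].
    by apply/ltW; move: M0; rewrite ltcE => /andP[].
  by rewrite -lecR rmorphM/= !rnormE -ME; exact: (TM (x, y) (conj I I)).
have [M M0 TM] := TL.
have pF : ProperFilter (globally ([set: Z] `*` [set: Z])).
  by apply: (@globally_properfilter _ _ (0, 0)).
apply: (@klipschitzW _ _ _ M%:C).
by move=> [x y] _ /=; rewrite -!rnormE -rmorphM lecR.
Qed.

Lemma Lnorm_ubound T : Lip0 T ->
  has_ubound [set r | exists x y, x <> y /\ r = rnorm (T x - T y) / rnorm (x - y)].
Proof.
move=> /Lip0P[[M M0 TM] _]; exists M => _ [x [y [/eqP xy ->]]].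
by rewrite ler_pdivrMr// rnorm_gt0 subr_eq0.
Qed.

Lemma Lnorm_ge T x y : Lip0 T -> rnorm (T x - T y) <= Lnorm T * rnorm (x - y).
Proof.
move=> LT; have [->|xy] := eqVneq x y; first by rewrite !subrr !rnorm0 mulr0.
rewrite -ler_pdivrMr ?rnorm_gt0 ?subr_eq0//.
by apply: ub_le_sup (Lnorm_ubound LT) _ _; exists x, y; split=> //; exact/eqP.
Qed.

Lemma Lnorm_le T M : 0 <= M ->
  (forall x y, rnorm (T x - T y) <= M * rnorm (x - y)) -> Lnorm T <= M.
Proof.
move=> M0 TM; rewrite /Lnorm; set E := [set _ | _].
have [->|/set0P E0] := eqVneq E set0; first by rewrite sup0.
apply: ge_sup => // _ [x [y [/eqP xy ->]]].
by rewrite ler_pdivrMr// rnorm_gt0 subr_eq0.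
Qed.

Lemma Lnorm_ge0 T : Lip0 T -> 0 <= Lnorm T.
Proof.
move=> LT; rewrite /Lnorm; set E := [set _ | _].
have [->|/set0P[r Er]] := eqVneq E set0; first by rewrite sup0.
apply: le_trans (ub_le_sup (Lnorm_ubound LT) Er).
by have [x [y [_ ->]]] := Er; rewrite divr_ge0 ?rnorm_ge0.
Qed.

Lemma nuL_ubound T : Lip0 T ->
  has_ubound [set r | exists x y (z' : dualType Z),
    [/\ x <> y, duality_map (x - y) z' &
        r = rnorm (z' (T x - T y)) / rnorm (x - y) ^+ 2]].
Proof.
move=> /Lip0P[[M M0 TM] _]; exists M => _ [x [y [z' [/eqP xy Dz ->]]]].
rewrite -subr_eq0 in xy; have nxy : 0 < rnorm (x - y) by rewrite rnorm_gt0.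
have [_ zn] := (duality_mapP _ xy).1 Dz.
rewrite ler_pdivrMr ?exprn_gt0//; apply: le_trans (zn _) _.
by rewrite mulrC expr2 mulrA ler_wpM2r ?rnorm_ge0.
Qed.

Lemma nuL_ge T x y (z' : dualType Z) : Lip0 T -> x != y -> duality_map (x - y) z' ->
  rnorm (z' (T x - T y)) <= nuL T * rnorm (x - y) ^+ 2.
Proof.
move=> LT xy Dz; rewrite -ler_pdivrMr ?exprn_gt0 ?rnorm_gt0 ?subr_eq0//.
by apply: ub_le_sup (nuL_ubound LT) _ _; exists x, y, z'; split=> //; exact/eqP.
Qed.

Lemma nuL_le T M : 0 <= M ->
    (forall x y (z' : dualType Z), x != y -> duality_map (x - y) z' ->
      rnorm (z' (T x - T y)) <= M * rnorm (x - y) ^+ 2) ->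
  nuL T <= M.
Proof.
move=> M0 TM; rewrite /nuL; set E := [set _ | _].
have [->|/set0P E0] := eqVneq E set0; first by rewrite sup0.
apply: ge_sup => // _ [x [y [z' [/eqP xy Dz ->]]]].
by rewrite ler_pdivrMr ?exprn_gt0 ?rnorm_gt0 ?subr_eq0//; exact: TM.
Qed.

Lemma nuL_ge0 T : Lip0 T -> 0 <= nuL T.
Proof.
move=> LT; rewrite /nuL; set E := [set _ | _].
have [->|/set0P[r Er]] := eqVneq E set0; first by rewrite sup0.
apply: le_trans (ub_le_sup (nuL_ubound LT) Er).
by have [x [y [z' [_ _ ->]]]] := Er; rewrite divr_ge0 ?exprn_ge0 ?rnorm_ge0.
Qed.

Lemma nL_le T : Lip0 T -> Lnorm T = 1 -> nL Z <= nuL T.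
Proof.
move=> LT T1; apply: ge_inf; last by exists T.
by exists 0 => _ [S [LS _] <-]; exact: nuL_ge0.
Qed.

(** On a nonzero space the identity has Lipschitz norm 1, so the infimum runs over a nonempty set
    and is not the default value 0. *)
Lemma nL_ge M : (exists z, z != 0) ->
  (forall T, Lip0 T -> Lnorm T = 1 -> M <= nuL T) -> M <= nL Z.
Proof.
move=> [z z0] MT; apply: lb_le_inf => [|_ [T [LT T1] <-]]; last exact: MT.
have Lid : Lip0 (@idfun Z).
  by apply/Lip0P; split=> //; exists 1 => // x y; rewrite mul1r.
exists (nuL (@idfun Z)), idfun => //; split=> //; apply/eqP.
rewrite eq_le Lnorm_le//=; last by move=> x y; rewrite mul1r.
rewrite -(@ler_pM2r _ (rnorm z)) ?rnorm_gt0// mul1r.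
by have := Lnorm_ge z 0 Lid; rewrite subr0.
Qed.

(** Homogeneity: [T] is divided by its norm; a map of norm 0 is treated apart. *)
Lemma nL_Lnorm T : Lip0 T -> nL Z * Lnorm T <= nuL T.
Proof.
move=> LT; have := Lnorm_ge0 LT; rewrite le_eqVlt => /orP[/eqP <-|T0].
  by rewrite mulr0 nuL_ge0.
pose S x := (Lnorm T)^-1%:C *: T x.
have SE x y : S x - S y = (Lnorm T)^-1%:C *: (T x - T y) by rewrite -scalerBr.
have nS (V : normedModType R[i]) (v : V) :
    rnorm ((Lnorm T)^-1%:C *: v) = rnorm v / Lnorm T.
  by rewrite rnormZr gtr0_norm ?invr_gt0// mulrC.
have SM x y : rnorm (S x - S y) <= 1 * rnorm (x - y).
  by rewrite SE nS ler_pdivrMr// mul1r mulrC; exact: Lnorm_ge.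
have LS : Lip0 S.
  by apply/Lip0P; split; [exists 1|rewrite /S (LT.2) scaler0].
rewrite -ler_pdivlMr//; apply: (@le_trans _ _ (nuL S)).
  apply: nL_le => //; apply/eqP; rewrite eq_le Lnorm_le//=.
  rewrite -(ler_pM2r T0) mul1r; apply: Lnorm_le => [|x y].
    by rewrite mulr_ge0 ?Lnorm_ge0.
  have := Lnorm_ge x y LS; rewrite SE nS ler_pdivrMr// => /le_trans; apply.
  by rewrite mulrAC.
apply: nuL_le => [|x y z' xy Dz]; first by rewrite divr_ge0 ?nuL_ge0 ?Lnorm_ge0.
by rewrite SE linearZ nS ler_pdivrMr// mulrAC divfK ?gt_eqF//; exact: nuL_ge.
Qed.

(* Duality is tested at [x - y'] with [y' := y - a l (T x - T y)], where
   [T x - T y'] differs from [T x - T y] by [O(a)] because [T] is Lipschitz. *)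
Lemma rnorm_perturb_le T x y (a : R) (l : R[i]) :
    Lip0 T -> 0 <= a -> a * nuL T < 1 -> rnorm (l : R[i]^o) = 1 ->
  (1 - a * nuL T) * rnorm (x - y + a%:C *: (l *: (T x - T y))) <=
  (1 + a ^+ 2 * Lnorm T ^+ 2) * rnorm (x - y).
Proof.
move=> LT a0 anu l1; set u := T x - T y; pose y' := y - a%:C *: (l *: u).
have xyE : x - y + a%:C *: (l *: u) = x - y' by rewrite /y' opprB addrA addrAC.
rewrite xyE.
have rhs0 : 0 <= (1 + a ^+ 2 * Lnorm T ^+ 2) * rnorm (x - y).
  by rewrite mulr_ge0 ?rnorm_ge0// -exprMn addr_ge0 ?ler01 ?sqr_ge0.
have [xy'|xy'] := eqVneq x y'; first by rewrite {1}xy' subrr rnorm0 mulr0.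
have xy'0 : x - y' != 0 by rewrite subr_eq0.
have nw : 0 < rnorm (x - y') by rewrite rnorm_gt0.
have [z' Dz] := hahn_banach_duality xy'0.
have [zz zn] := (duality_mapP _ xy'0).1 Dz.
pose u' := T x - T y'.
have uu' : rnorm (u - u') <= Lnorm T * (a * (Lnorm T * rnorm (x - y))).
  have -> : u - u' = T y' - T y by rewrite /u /u' opprB addrC addrA subrK.
  apply: le_trans (Lnorm_ge _ _ LT) _; rewrite ler_wpM2l ?Lnorm_ge0//.
  rewrite /y' addrAC subrr add0r rnormN rnormZr rnormZ l1 mul1r ger0_norm//.
  by rewrite ler_wpM2l//; exact: Lnorm_ge.
(* Removing [a l u'] from [x - y'] cancels the first-order term; the rest differs from [x - y] by
   [O(a^2)]. *)
have e : x - y' - a%:C *: (l *: u') = x - y + a%:C *: (l *: (u - u')).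
  by rewrite -xyE [l *: (u - u')]scalerBr [a%:C *: (_ - _)]scalerBr addrA.
have h1 : rnorm (z' (x - y' - a%:C *: (l *: u'))) <=
    rnorm (x - y') * ((1 + a ^+ 2 * Lnorm T ^+ 2) * rnorm (x - y)).
  apply: le_trans (zn _) _; rewrite ler_wpM2l ?rnorm_ge0// e.
  apply: le_trans (ler_rnormD _ _) _; rewrite mulrDl mul1r lerD2l.
  rewrite rnormZr rnormZ l1 mul1r ger0_norm//.
  apply: le_trans (ler_wpM2l a0 uu') _; rewrite le_eqVlt; apply/orP; left.
  by apply/eqP; ring.
rewrite -(ler_pM2l nw); apply: le_trans h1.
have zlin p q : z' (p - a%:C *: (l *: q)) = z' p - a%:C *: (l *: z' q).
  by rewrite linearB !linearZ.
rewrite zlin zz; apply: le_trans (ler_rnormB _ _).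
rewrite rnorm_real ger0_norm ?sqr_ge0// rnormZr rnormZ l1 mul1r ger0_norm//.
have := nuL_ge LT xy' Dz => /(ler_wpM2l a0); rewrite -/u' expr2; lra.
Qed.

End lipschitz_index.

(** * A polynomial mapping the disc close to the segment [0, 1] *)

Section thin_polynomial.
Variable R : realType.
Local Notation C := R[i].
Local Notation "|[ z ]|" := (rnorm (z : R[i]^o)) (format "|[ z ]|").
Implicit Types (z : C) (r : R).

Lemma ler_rnorm_sum (V : normedModType C) n (F : 'I_n -> V) :
  rnorm (\sum_(i < n) F i) <= \sum_(i < n) rnorm (F i).
Proof.
elim/big_ind2: _ => [|x y x' y' xy xy'|//]; first by rewrite rnorm0.
by apply: le_trans (ler_rnormD _ _) _; exact: lerD.
Qed.

(** On the unit disc this mean of powers is close to 1 where [m |1 - z|] is small and close to 0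
    where it is large. *)
Definition cesaro_poly m : {poly C} :=
  (m%:R^-1 : R)%:C *: \sum_(k < m) 'X^(k.+1).

Lemma cesaro_polyE m z :
  (cesaro_poly m).[z] = (m%:R^-1 : R)%:C * \sum_(k < m) z ^+ k.+1.
Proof.
rewrite hornerZ horner_sum; congr (_ * _); apply: eq_bigr => k _.
exact: hornerXn.
Qed.

Lemma cesaro_poly1 m : (0 < m)%N -> (cesaro_poly m).[1] = 1.
Proof.
move=> m0; rewrite cesaro_polyE (eq_bigr (fun=> 1)) => [|k _]; last exact: expr1n.
rewrite sumr_const card_ord -(rmorph_nat (real_complex R)) -rmorphM/=.
by rewrite mulVf// pnatr_eq0 -lt0n.
Qed.

Lemma cesaro_poly_le m z : |[z]| <= 1 -> |[(cesaro_poly m).[z]]| <= |[z]|.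
Proof.
move=> z1; have [->|m0] := posnP m.
  by rewrite cesaro_polyE big_ord0 mulr0 rnorm0 rnorm_ge0.
rewrite cesaro_polyE rnormM rnorm_real ger0_norm ?invr_ge0//.
rewrite ler_pdivrMl ?ltr0n//; apply: le_trans (ler_rnorm_sum _) _.
rewrite mulrC mulr_natr -[X in _ *+ X]card_ord -sumr_const.
apply: ler_sum => k _; rewrite rnormX exprS ler_piMr ?rnorm_ge0//.
by rewrite exprn_ile1 ?rnorm_ge0.
Qed.

(** Multiplied by [1 - z], the geometric sum telescopes to [z (1 - z^m)], of modulus at most 2. *)
Lemma cesaro_poly_far m z : |[z]| <= 1 ->
  |[(cesaro_poly m).[z]]| * (m%:R * |[1 - z]|) <= 2.
Proof.
move=> z1; have [->|m0] := posnP m; first by rewrite mul0r mulr0.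
rewrite cesaro_polyE rnormM rnorm_real ger0_norm ?invr_ge0//.
rewrite mulrACA mulVf ?pnatr_eq0 -?lt0n// mul1r -rnormM mulrC.
have -> : (1 - z) * \sum_(k < m) z ^+ k.+1 = z * (1 - z ^+ m).
  rewrite -[1 - z ^+ m]opprB -[1 - z]opprB subrX1 -mulNr mulrCA [z * _]mulr_sumr.
  by congr (_ * _); apply: eq_bigr => k _; rewrite exprS.
rewrite rnormM; apply: (@le_trans _ _ |[1 - z ^+ m]|).
  by rewrite ler_piMl ?rnorm_ge0.
apply: le_trans (ler_rnormD _ _) _; rewrite rnormN rnorm1 rnormX lerD2l.
by rewrite exprn_ile1 ?rnorm_ge0.
Qed.

Lemma rnorm_1subX m z : |[z]| <= 1 -> |[1 - z ^+ m]| <= m%:R * |[1 - z]|.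
Proof.
move=> z1; elim: m => [|m IH]; first by rewrite expr0 subrr rnorm0 mul0r.
have -> : 1 - z ^+ m.+1 = (1 - z) + z * (1 - z ^+ m) by rewrite exprS; ring.
apply: le_trans (ler_rnormD _ _) _; rewrite -natr1 mulrDl mul1r addrC lerD2r.
by rewrite rnormM; apply: le_trans IH; rewrite ler_piMl ?rnorm_ge0.
Qed.

Lemma cesaro_poly_near m z : (0 < m)%N -> |[z]| <= 1 ->
  |[1 - (cesaro_poly m).[z]]| <= m%:R * |[1 - z]|.
Proof.
move=> m0 z1; rewrite -{1}(cesaro_poly1 m0) !cesaro_polyE -mulrBr -sumrB.
rewrite rnormM rnorm_real ger0_norm ?invr_ge0// ler_pdivrMl ?ltr0n//.
apply: le_trans (ler_rnorm_sum _) _.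
have -> : m%:R * (m%:R * |[1 - z]|) = \sum_(k < m) (m%:R * |[1 - z]|).
  by rewrite sumr_const card_ord [LHS]mulr_natl.
apply: ler_sum => k _; rewrite expr1n; apply: le_trans (rnorm_1subX _ z1) _.
by rewrite ler_wpM2r ?rnorm_ge0// ler_nat.
Qed.

(* The bound comes from the potential [4 - 2 r] for [r <= 1], [2 / r] for [1 <= r]. *)
Lemma sum_dyadic_le (f : R -> R) n r :
  (forall s, 0 < s -> f s <= s) -> (forall s, 0 < s -> f s <= s^-1) -> 0 < r ->
  \sum_(j < n) f (2 ^+ j * r) <= 4.
Proof.
move=> fle fge r0; pose P r : R := if r <= 1 then 4 - 2 * r else 2 / r.
have P0 (s : R) : 0 < s -> 0 <= P s.
  by move=> s0; rewrite /P; case: ifP => s1; [lra|rewrite divr_ge0// ltW].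
(* Doubling [s] lowers the potential by at least [f s], so the sum telescopes to at most [P r]. *)
have PS (s : R) : 0 < s -> f s + P (2 * s) <= P s.
  move=> s0; have := fle _ s0; have := fge _ s0; rewrite /P.
  have sV : s * s^-1 = 1 by rewrite divff ?gt_eqF.
  have V0 : 0 < s^-1 by rewrite invr_gt0.
  have -> : 2 / (2 * s) = s^-1 by rewrite invfM mulrA divff ?pnatr_eq0// mul1r.
  case: (lerP (2 * s) 1) => s2; case: (lerP s 1) => s1; try lra.
  move=> fV fs; have V2 : s^-1 <= 2.
    by rewrite -(ler_pM2l s0) sV; lra.
  (* On [[1/2, 1]] the convex function [s^-1] lies below its chord [3 - 2 s]. *)
  have : 0 <= (1 - s) * (2 - s^-1) by rewrite mulr_ge0; lra.
  by rewrite mulrBl mulrBr mul1r mulrBr sV; lra.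
suff : \sum_(j < n) f (2 ^+ j * r) <= P r.
  move=> /le_trans; apply; rewrite /P; case: (lerP r 1) => r1; first lra.
  by rewrite ler_pdivrMr//; lra.
elim: n r r0 => [|n IH] s s0; first by rewrite big_ord0 P0.
rewrite big_ord_recl expr0 mul1r; apply: le_trans (PS _ s0); rewrite lerD2l.
apply: le_trans (IH (2 * s) _); last by rewrite mulr_gt0.
by apply: ler_sum => j _; rewrite exprSr mulrA.
Qed.

(* Averaging over dyadic scales: all but boundedly many terms take a value close
   to [0] or to [1], so the average maps the disc close to the segment [0, 1]. *)
Definition thin_poly n : {poly C} :=
  (n%:R^-1 : R)%:C *: \sum_(j < n) cesaro_poly (2 ^ j).

Lemma thin_polyE n z :
  (thin_poly n).[z] = (n%:R^-1 : R)%:C * \sum_(j < n) (cesaro_poly (2 ^ j)).[z].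
Proof. by rewrite hornerZ horner_sum. Qed.

Lemma thin_poly1 n : (0 < n)%N -> (thin_poly n).[1] = 1.
Proof.
move=> n0; rewrite thin_polyE (eq_bigr (fun=> 1)) => [|k _]; last first.
  by rewrite cesaro_poly1 ?expn_gt0.
rewrite sumr_const card_ord -(rmorph_nat (real_complex R)) -rmorphM/=.
by rewrite mulVf// pnatr_eq0 -lt0n.
Qed.

Lemma thin_poly_le n z : |[z]| <= 1 -> |[(thin_poly n).[z]]| <= |[z]|.
Proof.
move=> z1; have [->|n0] := posnP n.
  by rewrite thin_polyE big_ord0 mulr0 rnorm0 rnorm_ge0.
rewrite thin_polyE rnormM rnorm_real ger0_norm ?invr_ge0//.
rewrite ler_pdivrMl ?ltr0n//; apply: le_trans (ler_rnorm_sum _) _.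
rewrite mulrC mulr_natr -[X in _ *+ X]card_ord -sumr_const.
by apply: ler_sum => k _; exact: cesaro_poly_le.
Qed.

Lemma thin_poly_thin n z : (0 < n)%N -> |[z]| <= 1 ->
  |[(thin_poly n).[z]]| + |[1 - (thin_poly n).[z]]| <= 1 + 16 / n%:R.
Proof.
move=> n0 z1; have n0R : 0 < n%:R :> R by rewrite ltr0n.
have [->|z1'] := eqVneq z 1.
  by rewrite thin_poly1// subrr rnorm0 rnorm1 addr0 lerDl divr_ge0.
pose r := |[1 - z]|; have r0 : 0 < r by rewrite rnorm_gt0 subr_eq0 eq_sym.
pose f (s : R) := Num.min s s^-1.
have fle (s : R) : 0 < s -> f s <= s by move=> _; rewrite /f ge_min lexx.
have fge (s : R) : 0 < s -> f s <= s^-1 by move=> _; rewrite /f ge_min lexx orbT.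
pose b j := (cesaro_poly (2 ^ j)).[z].
(* With [s = 2^j r], the near bound gives an excess over 1 of at most [s]. The far bound
   [|b| <= 2 / s] and [|1 - b| <= 1 + |b|] give at most [4 / s]. The dyadic sum contributes another
   factor 4, whence 16. *)
have bf (j : nat) : |[b j]| + |[1 - b j]| <= 1 + 4 * f (2 ^+ j * r).
  have p0 : (0 < 2 ^ j)%N by rewrite expn_gt0.
  have s0 : 0 < 2 ^+ j * r by rewrite mulr_gt0// exprn_gt0.
  have b1 : |[b j]| <= 1 by apply: le_trans (cesaro_poly_le _ z1) z1.
  rewrite /f; case: (leP (2 ^+ j * r)) => _.
    by have := cesaro_poly_near p0 z1; rewrite natrX -/(b j) -/r; lra.
  have := cesaro_poly_far (2 ^ j) z1; rewrite natrX -/(b j) -/r => h.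
  have : |[b j]| <= 2 * (2 ^+ j * r)^-1 by rewrite -(ler_pM2r s0) divfK ?gt_eqF.
  have := ler_rnormD (1 : C^o) (- b j : C^o); rewrite rnormN rnorm1; lra.
have avg (u : nat -> C) : |[(n%:R^-1 : R)%:C * \sum_(j < n) u j]| <=
    n%:R^-1 * \sum_(j < n) |[u j]|.
  rewrite rnormM rnorm_real ger0_norm ?invr_ge0 ?ler0n//.
  by rewrite ler_wpM2l ?invr_ge0 ?ler0n//; exact: ler_rnorm_sum.
have e : 1 - (thin_poly n).[z] = (n%:R^-1 : R)%:C * \sum_(j < n) (1 - b j).
  rewrite -{1}(thin_poly1 n0) !thin_polyE -mulrBr -sumrB; congr (_ * _).
  by apply: eq_bigr => j _; rewrite cesaro_poly1 ?expn_gt0.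
rewrite e thin_polyE; apply: le_trans (lerD (avg b) (avg (fun j => 1 - b j))) _.
rewrite -mulrDr -big_split/= mulrC ler_pdivrMr//.
apply: (@le_trans _ _ (\sum_(j < n) (1 + 4 * f (2 ^+ j * r)))).
  by apply: ler_sum => j _; exact: bf.
have -> : (1 + 16 / n%:R) * n%:R = n%:R + 16 :> R.
  by rewrite mulrDl mul1r divfK ?gt_eqF.
rewrite big_split/= sumr_const card_ord -mulr_sumr lerD2l.
by have := sum_dyadic_le n fle fge r0; lra.
Qed.

End thin_polynomial.

(** * Peak sets of uniform algebras *)

(** Meant for [p = |g - M|], [s = |g + M|], [x = |g|]: the parallelogram law gives
    [p^2 <= 8 M d + d^2 <= 9 M d <= e^2 / 4], which explains the constant 36. *)
Lemma le_half_of_near_max (R : realType) (M d e p x s : R) :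
  0 <= e -> 0 <= p -> 0 <= x -> 0 <= d -> d <= M / 2 -> 36 * M * d <= e ^+ 2 ->
  p ^+ 2 + s ^+ 2 = 2 * x ^+ 2 + 2 * M ^+ 2 -> 2 * M - d <= s -> x <= M + d ->
  p <= e / 2.
Proof.
move=> e0 p0 x0 d0 dM de par sM xM.
have lo : (2 * M - d) ^+ 2 <= s ^+ 2 by rewrite lerXn2r ?nnegrE//; lra.
have hi : x ^+ 2 <= (M + d) ^+ 2 by rewrite lerXn2r ?nnegrE//; lra.
have dd : d * d <= M * d by rewrite ler_wpM2r//; lra.
rewrite -ler_sqr ?nnegrE ?divr_ge0//.
have -> : p ^+ 2 = 2 * x ^+ 2 + 2 * M ^+ 2 - s ^+ 2 by rewrite -par addrK.
have -> : (e / 2) ^+ 2 = e ^+ 2 / 4 by rewrite expr_div_n; congr (_ / _); ring.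
nra.
Qed.

Section peaks.
Variables (R : realType) (K : topologicalType) (cK : compact [set: K]).
Local Notation C := R[i].
Local Notation CK := (Cspace cK C^o).
Local Notation "|[ z ]|" := (rnorm (z : R[i]^o)) (format "|[ z ]|").

Lemma Cspace_rnorm_continuous (X : normedModType C) (f : Cspace cK X) :
  continuous (fun t => rnorm (f t)).
Proof.
by move=> t; apply: continuous_comp; [exact: cts_fun|exact: rnorm_continuous].
Qed.

Lemma closed_rnorm_max (X : normedModType C) (f : Cspace cK X) (P : set K) :
  closed P -> P !=set0 -> exists2 t, P t & forall s, P s -> rnorm (f s) <= rnorm (f t).
Proof.
move=> cP P0; have kP : compact P by apply: (subclosed_compact cP cK).
have [t Pt tmax] := compact_EVT_max P0 kP
  (continuous_subspaceT (@Cspace_rnorm_continuous _ f)).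
by exists t; [exact: set_mem|move=> s Ps; apply: tmax; exact: mem_set].
Qed.

Lemma exprn_small (q e : R) : 0 <= q < 1 -> 0 < e -> exists n, q ^+ n <= e.
Proof.
move=> /andP[q0 q1] e0; pose d := 1 - q; have d0 : 0 < d by rewrite subr_gt0.
have bern n : q ^+ n * (1 + n%:R * d) <= 1.
  elim: n => [|n]; first by rewrite expr0 mul0r addr0 mulr1.
  apply: le_trans; rewrite exprSr -mulrA ler_wpM2l ?exprn_ge0//.
  have n0 : 0 <= n%:R :> R by []; have qE : q = 1 - d by rewrite /d; ring.
  by rewrite -natr1 qE; nra.
have [n ln] : exists n : nat, (e * d)^-1 < n%:R.
  exists (Num.Def.archi_bound (e * d)^-1).
  by apply: archi_boundP; rewrite invr_ge0 mulr_ge0// ltW.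
have ed0 : 0 < e * d by rewrite mulr_gt0.
have n0 : 0 < n%:R :> R by apply: le_lt_trans ln; rewrite invr_ge0 ltW.
have le1 : 1 < n%:R * (e * d) by rewrite -ltr_pdivrMr// mul1r.
exists n; rewrite -(ler_pM2r (mulr_gt0 n0 d0)).
have := bern n; have : 0 <= q ^+ n by rewrite exprn_ge0.
lra.
Qed.

Section algebra.
Variables (A : set CK) (HA : uniform_algebra A).

Lemma uniform_algebra_poly (p : {poly C}) (psi : CK) : A psi ->
  exists2 phi : CK, A phi & forall t, phi t = p.[psi t].
Proof.
have [_ Al Am Ac _] := HA.
move=> Apsi; elim/poly_ind: p => [|p c [phi Aphi phiE]].
  by exists (Cmk cK (@cst_continuous K C^o 0)) => [|t]; [exact: Ac|rewrite horner0].
exists (1 *: Cmul phi psi + Cmk cK (@cst_continuous K C^o c)).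
  by apply: Al; [exact: Am|exact: Ac].
move=> t; rewrite hornerMXaddC -phiE.
by change (1 * (phi t * psi t) + c = phi t * psi t + c); rewrite mul1r.
Qed.

(** Plays the role of a neighbourhood of a strong boundary point: the maximum of [|psi|] is attained
    only inside [V]. No openness of [V] is asked. *)
Definition peak_nbhd (V : set K) := exists (psi : CK) (q : R),
  [/\ A psi, 0 <= q, exists t, q < |[psi t]| & forall t, ~ V t -> |[psi t]| <= q].

Lemma peak_nbhd_normalized V (e : R) : peak_nbhd V -> 0 < e ->
  exists (psi : CK) (t0 : K), [/\ A psi, psi t0 = 1, forall t, |[psi t]| <= 1
    & forall t, ~ V t -> |[psi t]| <= e].
Proof.
move=> [psi [q [Apsi q0 [t qt] Vq]]] e0.
have [|t0 _ t0max] := @closed_rnorm_max _ psi setT closedT; first by exists t.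
have q_t0 : q < |[psi t0]| by apply: lt_le_trans qt _; exact: t0max.
have m0 : 0 < |[psi t0]| by apply: le_lt_trans q_t0.
(* A high power of [psi / psi t0] is small off [V] and keeps the value 1 at [t0]. *)
have [|n qn] := @exprn_small (q / |[psi t0]|) e _ e0.
  by rewrite divr_ge0 ?rnorm_ge0//= ltr_pdivrMr// mul1r.
have [phi Aphi phiE] := uniform_algebra_poly (((psi t0)^-1 *: 'X) ^+ n) Apsi.
have nphi s : |[phi s]| = (|[psi s]| / |[psi t0]|) ^+ n.
  by rewrite phiE horner_exp hornerZ hornerX rnormX rnormM rnormV mulrC.
exists phi, t0; split=> // [|s|s nVs].
- by rewrite phiE horner_exp hornerZ hornerX mulVf ?expr1n// -(@rnorm_gt0 _ R[i]^o).
- rewrite nphi exprn_ile1 ?divr_ge0 ?rnorm_ge0// ler_pdivrMr// mul1r.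
  exact: t0max.
- rewrite nphi; apply: le_trans qn; rewrite lerXn2r ?nnegrE ?divr_ge0 ?rnorm_ge0//.
  by rewrite ler_pM2r ?invr_gt0//; exact: Vq.
Qed.

(* Near the peak set [P] of [psi], [psi ^+ N * (M + g)] has modulus close to its
   maximum [2 M] only where [g] is close to [M], the maximum of [|g|] on [P]. *)
Lemma peak_nbhd_osc (h : CK) V (e : R) : A h -> peak_nbhd V -> 0 < e ->
  exists V', [/\ V' `<=` V, peak_nbhd V' &
    forall s t, V' s -> V' t -> |[h s - h t]| <= e].
Proof.
have [_ Al Am Ac _] := HA.
move=> Ah pV e0; have h0 : 0 < 2^-1 :> R by rewrite invr_gt0.
have [psi [t0 [Apsi psi0 psi1 psiV]]] := peak_nbhd_normalized pV h0.
(* Adding [c] to [h] keeps its differences and makes [|h + c| >= 1], so that the maximum [M] below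
   is positive. *)
pose c : R := supnorm h + 1.
have hc t : 1 <= |[h t + c%:C]|.
  have := ler_rnormD (h t + c%:C : C^o) (- h t).
  rewrite addrAC subrr add0r rnormN rnorm_real.
  have := supnorm_ge h t; have := ler_norm c; rewrite /c; lra.
pose P := [set t | |[psi t]| = 1].
have cP : closed P.
  apply: (@preimage_closed _ _ (fun t => |[psi t]|) [set 1]); last exact: closed_eq.
  by move=> t _; exact: Cspace_rnorm_continuous.
have P0 : P !=set0 by exists t0; rewrite /P/= psi0 rnorm1.
pose g0 : CK := 1 *: h + Cmk cK (@cst_continuous K C^o c%:C).
have Ag0 : A g0 by apply: Al => //; exact: Ac.
have g0E t : g0 t = h t + c%:C by rewrite -[h t]scale1r.
have [t1 Pt1 t1max] := closed_rnorm_max g0 cP P0.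
pose M := |[g0 t1]|; have M1 : 1 <= M by rewrite /M g0E.
have M0 : 0 < M by apply: lt_le_trans M1.
have [l l1 lg] := rnorm_phase (g0 t1).
pose g t := l * g0 t.
have ng t : |[g t]| = |[g0 t]| by rewrite rnormM l1 mul1r.
have gmax t : |[g t]| <= supnorm g0 by rewrite ng; exact: supnorm_ge.
pose d := Num.min (M / 2) (e ^+ 2 / (36 * M)).
have d0 : 0 < d by rewrite lt_min !divr_gt0 ?exprn_gt0 ?mulr_gt0.
have dM : d <= M / 2 by rewrite ge_min lexx.
have de : 36 * M * d <= e ^+ 2.
  by rewrite mulrC -ler_pdivlMr ?mulr_gt0// ge_min lexx orbT.
pose U := [set t | |[g0 t]| < M + d].
(* [U] is open and contains [P], so [|psi| < 1] on its compact complement and the maximum there is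
   below 1. *)
have [q q01 Uq] : exists2 q : R, 0 <= q < 1 & forall t, ~ U t -> |[psi t]| <= q.
  have oU : open U.
    apply: (@open_comp _ _ (fun t => |[g0 t]|) [set x | x < M + d]); last exact: open_lt.
    by move=> t _; exact: Cspace_rnorm_continuous.
  have [U0|/set0P U0] := eqVneq (~` U) set0.
    exists 0; first by rewrite lexx ltr01.
    by move=> t nUt; exfalso; have : (~` U) t by []; rewrite U0.
  have [t2 nUt2 t2max] := closed_rnorm_max psi (open_closedC oU) U0.
  exists |[psi t2]| => //; rewrite rnorm_ge0 lt_neqAle psi1 andbT.
  apply/eqP => Pt2; apply: nUt2; rewrite /U/=.
  by apply: le_lt_trans (t1max _ Pt2) _; rewrite ltrDl.
pose B := M + supnorm g0; have B0 : 0 < B by rewrite ltr_wpDr ?supnorm_ge0.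
have [n qn] := exprn_small q01 (divr_gt0 M0 B0).
(* The [n]-th power brings [|F|] down to [M] off [U]. The extra factor [psi], at most 1/2 off [V],
   keeps [|F|] below [2 M - d] on [U] minus [V]. *)
have [psin Apsin psinE] := uniform_algebra_poly 'X^(n.+1) Apsi.
pose F : CK := Cmul psin (l *: g0 + Cmk cK (@cst_continuous K C^o M%:C)).
have AF : A F by apply: Am => //; apply: Al => //; exact: Ac.
have FE t : |[F t]| = |[psi t]| ^+ n.+1 * |[g t + M%:C]|.
  by rewrite -rnormX -rnormM; have := psinE t; rewrite hornerXn => <-.
have gM t : |[g t + M%:C]| <= |[g t]| + M.
  by apply: le_trans (ler_rnormD _ _) _; rewrite rnorm_real gtr0_norm.
have nU t : ~ U t -> |[F t]| <= M.
  move=> nUt; rewrite FE exprSr -mulrA.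
  apply: (@le_trans _ _ (q ^+ n * B)); last by rewrite -ler_pdivlMr.
  apply: ler_pM; rewrite ?exprn_ge0 ?mulr_ge0 ?rnorm_ge0//.
    by rewrite lerXn2r ?nnegrE ?rnorm_ge0 ?Uq//; case/andP: q01.
  apply: (@le_trans _ _ |[g t + M%:C]|); first by rewrite ler_piMl ?rnorm_ge0.
  by apply: le_trans (gM t) _; rewrite addrC lerD2l.
pose V' := [set t | 2 * M - d < |[F t]|].
have V'U t : V' t -> U t.
  by move=> V't; apply: contrapT => /nU; move: V't; rewrite /V'/=; lra.
have psin1 t : |[psi t]| ^+ n.+1 <= 1 by rewrite exprn_ile1 ?rnorm_ge0.
exists V'; split.
- move=> t V't; apply: contrapT => nVt.
  have gUt : |[g t]| < M + d by rewrite ng; exact: V'U.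
  have : |[F t]| <= 2^-1 * (|[g t]| + M).
    rewrite FE; apply: ler_pM; rewrite ?exprn_ge0 ?rnorm_ge0//.
    rewrite exprS; apply: le_trans (psiV _ nVt).
    by rewrite ler_piMr ?rnorm_ge0// exprn_ile1 ?rnorm_ge0.
  by move: V't; rewrite /V'/=; lra.
- exists F, (2 * M - d); split=> //; first by lra.
    exists t1; rewrite FE (Pt1 : |[psi t1]| = 1) expr1n mul1r /g lg -rmorphD rnorm_real.
    by rewrite -/M gtr0_norm; lra.
  by move=> t /negP; rewrite -leNgt.
have near t : V' t -> |[g t - M%:C]| <= e / 2.
  move=> V't; have gUt : |[g t]| < M + d by rewrite ng; exact: V'U.
  have gMt : 2 * M - d < |[g t + M%:C]|.
    by apply: lt_le_trans V't _; rewrite FE ler_piMl ?rnorm_ge0.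
  apply: le_half_of_near_max (ltW e0) (rnorm_ge0 _) (rnorm_ge0 _) (ltW d0) dM de _ (ltW gMt) (ltW gUt).
  exact: rnorm_parallelogram.
move=> s t V's V't; have -> : |[h s - h t]| = |[(g s - M%:C) - (g t - M%:C)]|.
  rewrite opprB addrA subrK /g -mulrBr rnormM l1 mul1r !g0E.
  by congr rnorm; ring.
apply: le_trans (ler_rnormD _ _) _; rewrite rnormN.
by have := near _ V's; have := near _ V't; lra.
Qed.

Lemma peak_nbhd_osc_seq (hs : seq CK) V (e : R) : {in hs, forall h, A h} ->
  peak_nbhd V -> 0 < e -> exists V', [/\ V' `<=` V, peak_nbhd V' &
    forall s t, V' s -> V' t -> {in hs, forall h : CK, |[h s - h t]| <= e}].
Proof.
elim: hs => [|h hs IH] Ahs pV e0; first by exists V; split.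
have [|V1 [V1V pV1 osc1]] := IH _ pV e0.
  by move=> k ks; apply: Ahs; rewrite inE ks orbT.
have [V2 [V2V1 pV2 osc2]] := peak_nbhd_osc (Ahs _ (mem_head _ _)) pV1 e0.
exists V2; split=> //; first exact: subset_trans V1V.
move=> s t V2s V2t k; rewrite inE => /orP[/eqP ->|ks]; first exact: osc2.
by apply: osc1 ks; exact: V2V1.
Qed.

(** The compact range of [w] has a finite [e/5]-net. Functionals norming the differences of net
    points give finitely many scalar functions, whose oscillation is made at most [e/5]. Net points
    near [w s] and [w t] are then within [3e/5], and two more errors of [e/5] give [e]. *)
Lemma peak_nbhd_osc_vector (X : normedModType C) (w : Cspace cK X) V (e : R) :
  (forall x' : dualType X, A (dual_comp x' w)) ->
  peak_nbhd V -> 0 < e -> exists V', [/\ V' `<=` V, peak_nbhd V' &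
    forall s t, V' s -> V' t -> rnorm (w s - w t) <= e].
Proof.
move=> Aw pV e0; have e5 : 0 < e / 5 by rewrite divr_gt0.
pose D (y : X) := [set x | rnorm (x - y) < e / 5].
have oD y : setT y -> open (D y).
  move=> _; apply: (@open_comp _ _ (fun x => rnorm (x - y)) [set r | r < e / 5]).
    move=> x _; apply: continuous_comp; last exact: rnorm_continuous.
    by apply: cvgB; [exact: cvg_id|exact: cvg_cst].
  exact: open_lt.
have cw : compact (range w).
  by apply: continuous_compact cK; apply: continuous_subspaceT; exact: cts_fun.
move: cw; rewrite compact_cover => /(_ _ setT D oD).
case=> [x _|N _ NK]; first by exists x => //; rewrite /D/= subrr rnorm0.
have Jex (x : X) : exists x' : dualType X,
    x' x = (rnorm x)%:C /\ forall y, rnorm (x' y) <= rnorm y.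
  by have [x' x'x x'n] := hahn_banach_norming x; exists x'.
have [J JP] := choice Jex.
pose hs := [seq dual_comp (J (i - j)) w | i <- N, j <- N].
have [|V' [V'V pV' osc]] := @peak_nbhd_osc_seq hs V (e / 5) _ pV e5.
  by move=> _ /allpairsP[[i j] [_ _ ->]].
exists V'; split=> // s t V's V't.
have [i iN Dis] := NK (w s) (imageP _ I); have [j jN Djt] := NK (w t) (imageP _ I).
have hosc := osc _ _ V's V't _ (allpairs_f (fun i j => dual_comp (J (i - j)) w) iN jN).
have [Jij Jn] := JP (i - j).
move: Dis Djt hosc Jij Jn; rewrite /D/=; move: (J (i - j)) => L Dis Djt hosc Lij Ln.
have Lst : |[L (w s) - L (w t)]| <= e / 5 by exact: hosc.
have ij : rnorm (i - j) <= 3 * (e / 5).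
  have -> : rnorm (i - j) = |[L (i - j)]|.
    by rewrite Lij rnorm_real ger0_norm ?rnorm_ge0.
  have -> : L (i - j) = (L (w t - j) - L (w s - i)) + (L (w s) - L (w t)).
    by rewrite !linearB/=; ring.
  apply: le_trans (ler_rnormD _ _) _; have := ler_rnormD (L (w t - j)) (- L (w s - i)).
  by rewrite rnormN; have := Ln (w t - j); have := Ln (w s - i); lra.
have -> : w s - w t = (w s - i) + (i - j) - (w t - j).
  by rewrite subrKA opprB addrA subrK.
apply: le_trans (ler_rnormD _ _) _; rewrite rnormN.
by have := ler_rnormD (w s - i) (i - j); lra.
Qed.

End algebra.
End peaks.

(** * Comparison of the numerical indices *)

Lemma le_of_small_defect (R : realType) (p q c a0 : R) : 0 < a0 ->
  (forall a, 0 < a -> a < a0 -> p - q <= a * c) -> p <= q.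
Proof.
move=> a00 H; rewrite leNgt; apply/negP => qp; have pq0 : 0 < p - q by rewrite subr_gt0.
have c0 : 0 < `|c| + 1 by rewrite ltr_wpDl.
pose a := Num.min (a0 / 2) ((p - q) / (2 * (`|c| + 1))).
have a_gt0 : 0 < a by rewrite lt_min !divr_gt0 ?mulr_gt0.
have aa0 : a < a0 by apply: (@le_lt_trans _ _ (a0 / 2)); [rewrite ge_min lexx|lra].
have ac : a * (2 * (`|c| + 1)) <= p - q.
  by rewrite -ler_pdivlMr ?mulr_gt0// ge_min lexx orbT.
have := H _ a_gt0 aa0; apply/negP; rewrite -ltNge.
apply: (@le_lt_trans _ _ (a * (`|c| + 1))); last by nra.
by rewrite ler_pM2l// ler_wpDr// ler_norm.
Qed.

Lemma exists_unit_direction (R : realType) (X : normedModType R[i]) (x : X) :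
  (exists z : X, z != 0) -> exists2 u : X, rnorm u = 1 & x = (rnorm x)%:C *: u.
Proof.
have unit (y : X) : y != 0 -> rnorm ((rnorm y)^-1%:C *: y) = 1.
  move=> y0; have ny : 0 < rnorm y by rewrite rnorm_gt0.
  by rewrite rnormZr gtr0_norm ?invr_gt0// mulVf ?gt_eqF.
move=> [z z0]; have [->|x0] := eqVneq x 0.
  by exists ((rnorm z)^-1%:C *: z); [exact: unit|rewrite rnorm0 scale0r].
exists ((rnorm x)^-1%:C *: x); first exact: unit.
by rewrite scalerA -rmorphM/= divff ?scale1r// gt_eqF// rnorm_gt0.
Qed.

Lemma defect_le_of_perturbation (R : realType) (a nu D p : R) : 0 < a ->
  (1 - a * nu) * (D + a * p) <= (1 + a ^+ 2) * D -> p - nu * D <= a * (D + nu * p).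
Proof. by move=> a0 h; rewrite -(ler_pM2l a0); nra. Qed.

Lemma small_step_bounds (R : realType) (a nu : R) : 0 < a -> 0 <= nu ->
  a * (2 * (nu + 1)) < 1 ->
  [/\ a < 2^-1, a * nu < 1, a ^+ 2 < 4^-1 & 0 <= 1 - 3 * a ^+ 2].
Proof.
move=> a0 nu0 h; have anu0 : 0 <= a * nu by rewrite mulr_ge0// ltW.
have a2 : a < 2^-1 by lra.
have a2' : a * a < 2^-1 * 2^-1 by rewrite ltr_pM// ltW.
by split; lra.
Qed.

(** The hypothesis is the outcome of [nL_transfer] for [e = a^2] and [c = 1 - 3 a^2]; after division
    by [a], all terms other than [k] and [nu] are [O(a)]. *)
Lemma index_defect_le (R : realType) (a nu k : R) :
  0 < a -> a < 2^-1 -> 0 <= nu -> 0 <= k ->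
  a * (1 - a * nu) * ((1 - 3 * a ^+ 2) * k) <=
    (1 + a ^+ 2) * (1 + a ^+ 2) - (1 - a * nu) ->
  k - nu <= a * (3 + k * (nu + 3)).
Proof.
move=> a0 a2 nu0 k0 h.
have aa : a * a <= a by rewrite ler_piMl ?ltW//; lra.
have aaa : a * a * a <= a by rewrite ler_piMl ?ltW//; lra.
have ak : a * a * k <= a * k by rewrite ler_wpM2r.
have ank : 0 <= a * a * a * nu * k by rewrite !mulr_ge0// ltW.
rewrite -(ler_pM2l a0).
have e1 : a * (k - nu) <= a * (2 * a + a * a * a + k * (a * nu + 3 * (a * a))).
  have : 0 <= a * (a * a * a * nu * k) by rewrite mulr_ge0// ltW.
  nra.
apply: le_trans e1 _; rewrite ler_pM2l//; nra.
Qed.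

Section AKX_index.
Variables (R : realType) (K : topologicalType) (cK : compact [set: K]).
Variable X : normedModType R[i].
Variable A : submodClosed (Cspace cK X).
Hypothesis HA : is_AKX A.
Local Notation C := R[i].
Local Notation W := (subspace_type A).
Local Notation "|[ z ]|" := (rnorm (z : R[i]^o)) (format "|[ z ]|").
Implicit Types (f g h : W) (t : K).

Definition in_subspace (F : Cspace cK X) (FA : F \in A) : W :=
  exist (fun F => F \in A) F FA.

Lemma subspace_valB f g t : val (f - g) t = val f t - val g t.
Proof. by []. Qed.

Lemma subspace_valD f g t : val (f + g) t = val f t + val g t.
Proof. by []. Qed.

Lemma subspace_valZ (a : C) f t : val (a *: f) t = a *: val f t.
Proof. by []. Qed.

Lemma subspace_eval_le f t : rnorm (val f t) <= rnorm f.
Proof. exact: supnorm_ge. Qed.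

Lemma subspace_rnorm_le f (M : R) :
  0 <= M -> (forall t, rnorm (val f t) <= M) -> rnorm f <= M.
Proof. exact: supnorm_le. Qed.

Lemma subspace_eqP f g : (forall t, val f t = val g t) -> f = g.
Proof. by move=> fg; apply: val_inj; exact: Cspace_eqP. Qed.

Lemma AKX_nonzero (K0 : [set: K] !=set0) :
  (exists x : X, x != 0) /\ exists f, f != 0.
Proof.
have [_ [_ _ _ Ac _] _ _] := HA; have [t _] := K0.
have [f fA [x' xf]] := Ac 1.
have xft : x' (f t) = 1.
  by have /(congr1 (fun k : Cspace cK C^o => k t)) /= := xf.
have ft : f t != 0.
  apply/eqP => f0; move: xft; rewrite f0 linear0 => /esym/eqP.
  by rewrite oner_eq0.
split; first by exists (f t).
exists (in_subspace fA); apply: contraNneq ft => /(congr1 (fun k : W => val k t)).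
by move=> /= ->.
Qed.

(** The perturbation estimate for [S] holds at every point of [K]; its supremum is an estimate in
    [A(K,X)], against which a functional of the duality map is tested. *)
Lemma nL_AKX_le (K0 : [set: K] !=set0) :
  (forall (S : X -> X) (lS : Lip0 S), range (QS (S := A) lS) `<=` [set` A]) ->
  nL W <= nL X.
Proof.
move=> HQ; have [Xn0 [f0 _]] := AKX_nonzero K0; apply: nL_ge => // S lS S1.
pose T f : W := in_subspace (HQ S lS _ (imageT _ f)).
have TE f t : val (T f) t = S (val f t) by [].
have TL f g : rnorm (T f - T g) <= rnorm (f - g).
  apply: subspace_rnorm_le => [|t]; first exact: rnorm_ge0.
  rewrite subspace_valB !TE; apply: le_trans (Lnorm_ge _ _ lS) _.
  by rewrite S1 mul1r; exact: (subspace_eval_le (f - g)).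
have LT : Lip0 T.
  apply/Lip0P; split; last by apply: subspace_eqP => t; rewrite TE /= lS.2.
  by exists 1 => // f g; rewrite mul1r; exact: TL.
have [_ [_ _ _ Ac _] At _] := HA; have [t0 _] := K0.
have T1 : Lnorm T = 1.
  apply/eqP; rewrite eq_le Lnorm_le//=; last first.
    move=> f g; rewrite mul1r; exact: TL.
  rewrite -[X in X <= _]S1; apply: Lnorm_le => [|x y]; first exact: Lnorm_ge0.
  (* On constant functions [T] acts as [S], so lifting loses no Lipschitz norm. *)
  pose cst z : W := in_subspace (At _ z (Ac 1)).
  have cstE z t : val (cst z) t = z by exact: scale1r.
  have := subspace_eval_le (T (cst x) - T (cst y)) t0.
  rewrite subspace_valB !TE !cstE => /le_trans; apply.
  apply: le_trans (Lnorm_ge _ _ LT) _; rewrite ler_wpM2l ?Lnorm_ge0//.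
  apply: subspace_rnorm_le => [|t]; first exact: rnorm_ge0.
  by rewrite subspace_valB !cstE.
apply: le_trans (nL_le LT T1) _; apply: nuL_le => [|f g z' fg Dz].
  exact: nuL_ge0.
have fg0 : f - g != 0 by rewrite subr_eq0.
have [zz zn] := (duality_mapP _ fg0).1 Dz.
set d := rnorm (f - g) in zz zn *; set p := rnorm _; set nu := nuL S.
have nu0 : 0 <= nu by exact: nuL_ge0.
have d0 : 0 < d by rewrite rnorm_gt0.
apply: (@le_of_small_defect _ _ _ (d ^+ 2 + nu * p) (nu + 1)^-1).
  by rewrite invr_gt0 ltr_wpDl.
move=> a a0 anu; have {}anu : a * nu < 1.
  apply: (@le_lt_trans _ _ (a * (nu + 1))); first by rewrite ler_pM2l// lerDl.
  by rewrite -ltr_pdivlMr ?div1r// ltr_wpDl.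
have [l l1 lz] := rnorm_phase (z' (T f - T g)).
have key : (1 - a * nu) * rnorm (f - g + a%:C *: (l *: (T f - T g))) <=
    (1 + a ^+ 2) * d.
  have anu1 : 0 < 1 - a * nu by rewrite subr_gt0.
  rewrite mulrC -ler_pdivlMr//; apply: subspace_rnorm_le => [|t].
    by rewrite divr_ge0 ?(ltW anu1)// mulr_ge0 ?(ltW d0)// addr_ge0 ?ler01 ?sqr_ge0.
  rewrite ler_pdivlMr// mulrC.
  rewrite subspace_valD !subspace_valZ !subspace_valB !TE.
  apply: le_trans (rnorm_perturb_le _ _ lS (ltW a0) anu l1) _.
  rewrite S1 expr1n mulr1 ler_wpM2l ?addr_ge0 ?sqr_ge0//.
  exact: (subspace_eval_le (f - g)).
have h := zn (f - g + a%:C *: (l *: (T f - T g))).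
have e : z' (f - g + a%:C *: (l *: (T f - T g))) = (d ^+ 2 + a * p)%:C.
  transitivity ((d ^+ 2)%:C + a%:C * p%:C); last by rewrite -rmorphM -rmorphD.
  by rewrite linearD !linearZ/= zz; congr (_ + _ * _).
rewrite e rnorm_real ger0_norm in h; last first.
  by rewrite addr_ge0 ?sqr_ge0// mulr_ge0 ?rnorm_ge0// ltW.
apply: defect_le_of_perturbation => //.
have anu1 : 0 <= 1 - a * nu by rewrite subr_ge0 ltW.
  apply: le_trans (ler_wpM2l anu1 h) _; rewrite [X in X <= _]mulrCA expr2.
by rewrite [X in _ <= X]mulrCA (ler_pM2l d0).
Qed.

(** The map [S] below is [T] read through [Psi] and evaluation at [t0]; its norm is at least [c]. A
    functional dual to [x - y], composed with evaluation at [t0], norms [Psi x - Psi y] up to the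
    factor [1 + e], so the perturbation estimate for [T] bounds [nuL S]. *)
Lemma nL_transfer (K0 : [set: K] !=set0) (T : W -> W) (Psi : X -> W) t0 (v : X) (a e c : R) :
  Lip0 T -> Lnorm T = 1 -> 0 < a -> a * nuL T < 1 -> 0 <= e -> 0 <= c ->
  (forall x y, rnorm (Psi x - Psi y) <= (1 + e) * rnorm (x - y)) ->
  (forall x y, val (Psi x) t0 - val (Psi y) t0 = x - y) ->
  v != 0 -> c * rnorm v <= rnorm (val (T (Psi v) - T (Psi 0)) t0) ->
  a * (1 - a * nuL T) * (c * nL X) <= (1 + a ^+ 2) * (1 + e) - (1 - a * nuL T).
Proof.
move=> LT T1 a0; set nu := nuL T => anu e0 c0 PsiL Psi0 v0 Tv.
have anu1 : 0 < 1 - a * nu by rewrite subr_gt0.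
have [Xn0 _] := AKX_nonzero K0.
have nLX0 : 0 <= nL X by apply: nL_ge => // S LS _; exact: nuL_ge0.
pose S x := val (T (Psi x) - T (Psi 0)) t0.
have SB x y : S x - S y = val (T (Psi x) - T (Psi y)) t0.
  by rewrite /S !subspace_valB opprB addrA subrK.
have SM x y : rnorm (S x - S y) <= (1 + e) * rnorm (x - y).
  rewrite SB; apply: le_trans (subspace_eval_le _ _) _.
  by apply: le_trans (Lnorm_ge _ _ LT) _; rewrite T1 mul1r.
have LS : Lip0 S.
  apply/Lip0P; split; last by rewrite /S subrr.
  by exists (1 + e) => //; rewrite addr_ge0.
have cS : c <= Lnorm S.
  rewrite -(@ler_pM2r _ (rnorm v)) ?rnorm_gt0//.
  apply: le_trans Tv _; have := Lnorm_ge v 0 LS; rewrite subr0.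
  by rewrite SB.
pose B := ((1 + a ^+ 2) * (1 + e) - (1 - a * nu)) / (a * (1 - a * nu)).
have nu0 : 0 <= nu by exact: nuL_ge0.
have aanu : 0 < a * (1 - a * nu) by rewrite mulr_gt0.
have B0 : 0 <= B.
  rewrite divr_ge0 ?(ltW aanu)// subr_ge0.
  apply: (@le_trans _ _ 1); first by rewrite gerBl mulr_ge0// ltW.
  by rewrite -[leLHS]mulr1 ler_pM// ?lerDl ?sqr_ge0.
rewrite mulrC -ler_pdivlMr// -/B mulrC.
apply: (@le_trans _ _ (nL X * Lnorm S)); first by rewrite ler_wpM2l.
apply: le_trans (nL_Lnorm LS) _; apply: nuL_le => // x y x' xy Dx.
have xy0 : x - y != 0 by rewrite subr_eq0.
have [xx xn] := (duality_mapP _ xy0).1 Dx.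
set d := rnorm (x - y) in xx xn *; have d0 : 0 < d by rewrite rnorm_gt0.
set p := rnorm _; set u := T (Psi x) - T (Psi y).
have [l l1 lx] := rnorm_phase (x' (S x - S y)).
set w := Psi x - Psi y + a%:C *: (l *: u).
have h1 : d ^+ 2 + a * p <= d * rnorm w.
  apply: le_trans (_ : d * rnorm (val w t0) <= _); last first.
    by rewrite ler_wpM2l ?rnorm_ge0//; exact: subspace_eval_le.
  apply: le_trans (xn _).
  have -> : x' (val w t0) = (d ^+ 2 + a * p)%:C.
    transitivity ((d ^+ 2)%:C + a%:C * p%:C); last by rewrite -rmorphM -rmorphD.
    rewrite subspace_valD !subspace_valZ subspace_valB Psi0 -SB.
    by rewrite linearD !linearZ/= xx; congr (_ + _ * _).
  by rewrite rnorm_real ler_norm.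
have h2 : (1 - a * nu) * rnorm w <= (1 + a ^+ 2) * ((1 + e) * d).
  apply: le_trans (rnorm_perturb_le _ _ LT (ltW a0) anu l1) _.
  by rewrite T1 expr1n mulr1 ler_wpM2l ?PsiL// addr_ge0 ?ler01 ?sqr_ge0.
have : (1 - a * nu) * (d ^+ 2 + a * p) <= (1 + a ^+ 2) * (1 + e) * d ^+ 2.
  apply: le_trans (ler_wpM2l (ltW anu1) h1) _; rewrite mulrCA.
  have -> : (1 + a ^+ 2) * (1 + e) * d ^+ 2 = d * ((1 + a ^+ 2) * ((1 + e) * d)).
    by ring.
  by rewrite ler_pM2l.
move=> h3; rewrite [leRHS]mulrAC ler_pdivlMr//.
have -> : p * (a * (1 - a * nu)) = (1 - a * nu) * (d ^+ 2 + a * p) - (1 - a * nu) * d ^+ 2.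
  by ring.
by rewrite [leRHS]mulrBl lerD2r.
Qed.

(* [(1 - phi) w + phi (w t0)] approximates [w], but its value at [t0] may be shorter
   than [D], the norm of [w]. It is [(1 - r) w1 + r w2] where [w1 t0 = D u] and
   [w2 t0 = - D u], [u] being the direction of [w t0], so [T] almost attains its norm
   on one of the two steps from [g] to [h := g + (1 - r) w1] to [f' := h + r w2]. *)
Lemma peak_interpolation (K0 : [set: K] !=set0) (T : W -> W) (e : R) :
  Lip0 T -> Lnorm T = 1 -> 0 < e -> e < 4^-1 ->
  exists (Psi : X -> W) t0 (v : X), [/\
    forall x y, rnorm (Psi x - Psi y) <= (1 + e) * rnorm (x - y),
    forall x y, val (Psi x) t0 - val (Psi y) t0 = x - y,
    v != 0 &
    (1 - 3 * e) * rnorm v <= rnorm (val (T (Psi v) - T (Psi 0)) t0)].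
Proof.
move=> LT T1 e0 e4; have [_ UA At Am] := HA.
have e1 : 0 < 1 - e by lra.
have e3 : 0 < 1 - 3 * e by lra.
have e1' : 0 <= 1 + e by lra.
have e41 : e / 4 < 1 by lra.
have e31 : 1 - 3 * e + e <= (1 - e) * (1 - e) by nra.
have [f [g fg]] : exists f g, (1 - e) * rnorm (f - g) < rnorm (T f - T g).
  apply: contrapT => nfg; have : Lnorm T <= 1 - e; last by rewrite T1; lra.
  apply: Lnorm_le => [|f g]; first exact: ltW.
  by rewrite leNgt; apply/negP => fg; apply: nfg; exists f, g.
set w := f - g in fg; set F := T f - T g in fg.
set D := rnorm w in fg; set d := rnorm F in fg.
have FD : d <= D by have := Lnorm_ge f g LT; rewrite T1 mul1r.
have w0 : D != 0.
  by apply/eqP => D0; move: fg; rewrite D0 mulr0 ltNge -[X in _ <= X]D0 FD.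
have D0 : 0 < D by rewrite lt_def w0 rnorm_ge0.
have d0 : 0 < d by apply: lt_trans fg; rewrite mulr_gt0.
have [t1 _ t1max] := closed_rnorm_max (val F) closedT K0.
have dt1 : rnorm (val F t1) = d.
  apply/eqP; rewrite eq_le subspace_eval_le/=.
  by apply: subspace_rnorm_le => [|t]; [exact: rnorm_ge0|exact: t1max].
have [x' x'F x'n] := hahn_banach_norming (val F t1).
have Adual (x'' : dualType X) (h : W) : base_algebra [set` A] (dual_comp x'' (val h)).
  by exists (val h) => //; [exact: valP|exists x''].
(* The scalar function [x' o F], with [x'] norming [F t1], shows that the set where [F] is almost
   maximal is a peak neighbourhood. *)
pose V0 := [set t | (1 - e) * d < rnorm (val F t)].
have pV0 : peak_nbhd (base_algebra [set` A]) V0.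
  exists (dual_comp x' (val F)), ((1 - e) * d); split=> //.
  - by rewrite mulr_ge0// ltW.
  - exists t1; rewrite [X in rnorm X]x'F rnorm_real dt1 gtr0_norm//.
    by rewrite gtr_pMl// gtrBl.
  - by move=> t /negP; rewrite -leNgt; exact: le_trans (x'n _).
have eD0 : 0 < e * D / 2 by rewrite divr_gt0 ?mulr_gt0.
have [V [VV0 pV osc]] :=
  peak_nbhd_osc_vector UA (fun x'' => Adual x'' w) pV0 eD0.
have e4' : 0 < e / 4 by rewrite divr_gt0.
have [psi [t0 [Apsi psi0 psi1 psiV]]] := peak_nbhd_normalized UA pV e4'.
have Vt0 : V t0.
  by apply: contrapT => /psiV; rewrite psi0 rnorm1 leNgt e41.
have [n n0 ne] : exists2 n, (0 < n)%N & 16 / n%:R <= e.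
  have e16 : 0 <= 16 / e by rewrite divr_ge0// ltW.
  exists (Num.Def.archi_bound (16 / e)).
    by rewrite -(ltr_nat R); apply: le_lt_trans (archi_boundP e16).
  rewrite ler_pdivrMr; last by apply: le_lt_trans (archi_boundP e16).
  by rewrite mulrC -ler_pdivrMr//; exact: ltW (archi_boundP e16).
have [phi Aphi phiE] := uniform_algebra_poly UA (thin_poly R n) Apsi.
have phi0 : phi t0 = 1 by rewrite phiE psi0 thin_poly1.
have phi_psi t : |[phi t]| <= |[psi t]| by rewrite phiE; exact: thin_poly_le.
have phi1 t : |[phi t]| <= 1 by apply: le_trans (phi_psi t) _.
have phithin t : |[phi t]| + |[1 - phi t]| <= 1 + e.
  by rewrite phiE; apply: le_trans (thin_poly_thin n0 (psi1 t)) _; rewrite lerD2l.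
pose x0 := val w t0.
(* On [V] the oscillation of [w] is small; off [V] the factor [phi] is at most [e/4] and the
   difference at most [2 D]. *)
have phiw t : rnorm (phi t *: (x0 - val w t)) <= e * D.
  rewrite rnormZ; have [Vt|nVt] := pselect (V t).
    apply: le_trans (_ : 1 * (e * D / 2) <= _).
      by apply: ler_pM; rewrite ?rnorm_ge0 ?phi1//; exact: osc.
    by rewrite mul1r ler_pdivrMr// ler_peMr ?ler1n// mulr_ge0// ltW.
  have -> : e * D = e / 4 * (D + D) + e / 4 * (D + D) by field.
  apply: le_trans (_ : e / 4 * (D + D) <= _); last first.
    by rewrite lerDl mulr_ge0 ?addr_ge0// ltW.
  apply: ler_pM; rewrite ?rnorm_ge0//; first by apply: le_trans (psiV _ nVt).
  by apply: le_trans (ler_rnormD _ _) _; rewrite rnormN lerD ?subspace_eval_le.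
have [Xn0 _] := AKX_nonzero K0.
have [u u1 x0u] := exists_unit_direction x0 Xn0.
have [u' u'u u'n] := hahn_banach_norming u.
have A1phi : base_algebra [set` A] (-1 *: phi + Cmk cK (@cst_continuous K C^o 1)).
  by have [_ Al _ Ac _] := UA; apply: Al.
pose W1 : W := in_subspace (Am _ _ A1phi (valP w)).
have W1E t : val W1 t = (1 - phi t) *: val w t.
  by rewrite [1 - _]addrC -[- phi t]scaleN1r.
pose W2 x : W := in_subspace (At _ x Aphi).
have W2E x t : val (W2 x) t = phi t *: x by [].
(* Linear in [x], with value [x] at [t0]. For [|s| = 1] the pointwise norm is at most
   [(|1 - phi| + |phi|) |x|], since [|w| <= D] and [|u' x| <= |x|]. *)
pose Phi (s : R) x : W := ((s / D)%:C * u' x) *: W1 + W2 x.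
have PhiE s x t : val (Phi s x) t =
    ((s / D)%:C * u' x) *: ((1 - phi t) *: val w t) + phi t *: x.
  by rewrite subspace_valD subspace_valZ W1E W2E.
have PhiB s x y : Phi s x - Phi s y = Phi s (x - y).
  apply: subspace_eqP => t; rewrite subspace_valB !PhiE (linearB u').
  by rewrite mulrBr [(_ * _ - _) *: _]scalerBl [phi t *: (x - y)]scalerBr opprD addrACA.
have Phin s x : `|s| = 1 -> rnorm (Phi s x) <= (1 + e) * rnorm x.
  move=> s1; apply: subspace_rnorm_le => [|t].
    by rewrite mulr_ge0 ?rnorm_ge0.
  rewrite PhiE; apply: le_trans (ler_rnormD _ _) _.
  rewrite !rnormZ rnorm_real normrM s1 mul1r gtr0_norm ?invr_gt0//.
  apply: le_trans (_ : |[1 - phi t]| * rnorm x + |[phi t]| * rnorm x <= _).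
    rewrite lerD2r [D^-1 * _]mulrC -mulrA [D^-1 * _]mulrC -!mulrA mulrCA.
    rewrite ler_wpM2l ?rnorm_ge0// -[leRHS]mulr1.
    apply: ler_pM; rewrite ?rnorm_ge0 ?divr_ge0 ?rnorm_ge0 ?(ltW D0) ?u'n//.
    by rewrite ler_pdivrMr// mul1r subspace_eval_le.
  by rewrite -mulrDl ler_wpM2r ?rnorm_ge0// addrC.
have Phi0 s x : val (Phi s x) t0 = x.
  by rewrite PhiE phi0 subrr scale0r scaler0 add0r scale1r.
have PsiL s h x y : `|s| = 1 ->
    rnorm ((h + Phi s x) - (h + Phi s y)) <= (1 + e) * rnorm (x - y).
  by move=> s1; rewrite opprD addrACA subrr add0r PhiB; exact: Phin.
have Psi0 s h x y : val (h + Phi s x) t0 - val (h + Phi s y) t0 = x - y.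
  rewrite (subspace_valD h (Phi s x)) (subspace_valD h (Phi s y)) !Phi0.
  by rewrite opprD addrACA subrr add0r.
have Phi00 s : Phi s 0 = 0.
  by apply: subspace_eqP => t; rewrite PhiE linear0 mulr0 scale0r scaler0 addr0.
(* Chosen so that [(1 - 2 r) D = |x0|]: then [p1 + p2 = x0], the coefficients of [(1 - phi) w] add
   up to 1, and [|p1| + |p2| = D]. *)
pose r := (1 - rnorm x0 / D) / 2.
pose p1 := ((1 - r) * D)%:C *: u; pose p2 := (- (r * D))%:C *: u.
pose h := g + Phi 1 p1; pose f' := h + Phi (-1) p2.
have f'f : rnorm (f' - f) <= e * D.
  apply: subspace_rnorm_le => [|t]; first by rewrite mulr_ge0// ltW.
  have -> : val (f' - f) t = phi t *: (x0 - val w t); last exact: phiw.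
  have -> : f' - f = Phi 1 p1 + Phi (-1) p2 - w.
    by rewrite /f' /h /w opprB [RHS]addrA -[g + _ + _]addrA [g + _]addrC.
  rewrite subspace_valB (subspace_valD (Phi 1 p1)) !PhiE.
  have u'Z (s : R) : u' (s%:C *: u) = s%:C.
    by rewrite linearZ/= u'u u1; exact: mulr1.
  have -> : (1 / D)%:C * u' p1 = (1 - r)%:C.
    by rewrite u'Z -rmorphM/= mulrCA mul1r mulVf ?mulr1.
  have -> : (-1 / D)%:C * u' p2 = r%:C.
    by rewrite u'Z -rmorphM/= mulN1r mulrNN mulrCA mulVf ?mulr1.
  have -> : x0 = p1 + p2.
    rewrite /p1 /p2 -scalerDl -rmorphD -mulrBl [LHS]x0u; congr (_%:C *: _).
    rewrite /r; field; exact: w0.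
  rewrite addrACA -scalerDl -rmorphD subrK scale1r -scalerDr.
  rewrite [(1 - phi t) *: _]scalerBl scale1r [RHS]scalerBr addrAC.
  by rewrite [val w t - _]addrC addrK addrC.
(* One factor [1 - e] is lost in choosing [f, g], one in [t0] lying in [V0], and [e D] in replacing
   [f] by [f']. *)
have Tf'g : (1 - 3 * e) * D < rnorm (val (T f' - T g) t0).
  have -> : val (T f' - T g) t0 = val F t0 - val (T f - T f') t0.
    by rewrite /F !subspace_valB opprB [RHS]addrC [RHS]addrA subrK.
  apply: lt_le_trans (ler_rnormB _ _).
  have Ft0 : (1 - e) * d < rnorm (val F t0) by exact: VV0.
  have Tff' : rnorm (val (T f - T f') t0) <= e * D.
    apply: le_trans (subspace_eval_le _ _) _; apply: le_trans (Lnorm_ge _ _ LT) _.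
    by rewrite T1 mul1r rnorm_distC.
  rewrite ltrBrDr; apply: le_lt_trans Ft0.
  apply: le_trans (ler_wpM2l (ltW e1) (ltW fg)).
  apply: le_trans (_ : (1 - 3 * e) * D + e * D <= _); first by rewrite lerD2l.
  by rewrite -mulrDl mulrA ler_pM2r.
have x0D : rnorm x0 <= D by exact: subspace_eval_le.
have r0 : 0 <= r by rewrite divr_ge0// subr_ge0 ler_pdivrMr// mul1r.
have r1 : 0 < 1 - r.
  rewrite subr_gt0 ltr_pdivrMr// mul1r ltrBlDr.
  apply: (@lt_le_trans _ _ 2); first by rewrite ltr1n.
  by rewrite lerDl divr_ge0 ?rnorm_ge0// ltW.
have np1 : rnorm p1 = (1 - r) * D by rewrite rnormZr u1 mulr1 gtr0_norm ?mulr_gt0.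
have np2 : rnorm p2 = r * D by rewrite rnormZr u1 mulr1 normrN ger0_norm // mulr_ge0 ?(ltW D0).
(* The steps have lengths adding up to [D], so if the first falls short of the ratio [1 - 3 e], the
   second exceeds it. *)
have [hg|hg] := leP ((1 - 3 * e) * rnorm p1) (rnorm (val (T h - T g) t0)).
  exists (fun x => g + Phi 1 x), t0, p1; split.
  - by move=> x y; apply: PsiL; rewrite normr1.
  - by move=> x y; exact: Psi0.
  - by rewrite -rnorm_gt0 np1 mulr_gt0.
  - by rewrite Phi00 addr0.
have f'h : (1 - 3 * e) * rnorm p2 < rnorm (val (T f' - T h) t0).
  rewrite np2 -(ltrD2r ((1 - 3 * e) * rnorm p1)) np1 -mulrDr -mulrDl (addrC r) subrK mul1r.
  apply: lt_trans Tf'g _.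
  have -> : val (T f' - T g) t0 = val (T f' - T h) t0 + val (T h - T g) t0.
    by rewrite !subspace_valB addrA subrK.
  apply: le_lt_trans (ler_rnormD _ _) _; rewrite ltrD2l -np1.
  exact: hg.
exists (fun x => h + Phi (-1) x), t0, p2; split.
- by move=> x y; apply: PsiL; rewrite normrN1.
- by move=> x y; exact: Psi0.
(* [p2] vanishes if [r = 0]; the strict inequality [f'h] excludes this case. *)
- apply/eqP => p20; move: f'h; rewrite /f' p20 Phi00 addr0 subrr !rnorm0 mulr0.
  by rewrite ltxx.
- by rewrite Phi00 addr0 ltW.
Qed.

Lemma nL_AKX_ge (K0 : [set: K] !=set0) : nL X <= nL W.
Proof.
have [Xn0 Wn0] := AKX_nonzero K0; apply: nL_ge => // T LT T1.
have nu0 := nuL_ge0 LT.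
have k0 : 0 <= nL X by apply: nL_ge => // S LS _; exact: nuL_ge0.
apply: (@le_of_small_defect _ _ _ (3 + nL X * (nuL T + 3)) (2 * (nuL T + 1))^-1).
  by rewrite invr_gt0 mulr_gt0// ltr_wpDl.
move=> a a0; rewrite -[_^-1]mul1r ltr_pdivlMr ?mulr_gt0 ?ltr_wpDl// => anu.
have [a2 anu1 a24 c0] := small_step_bounds a0 nu0 anu.
(* The distortion is taken to be [a^2], so that it stays of lower order after division by the step
   [a]. *)
have [Psi [t0 [v [PsiL Psi0 v0 Tv]]]] :=
  peak_interpolation K0 LT T1 (exprn_gt0 2 a0) a24.
have h := nL_transfer K0 LT T1 a0 anu1 (sqr_ge0 a) c0 PsiL Psi0 v0 Tv.
exact: index_defect_le a0 a2 nu0 k0 h.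
Qed.

End AKX_index.

Theorem theorem3p13 (R : realType)
    (K : topologicalType) (cK : compact [set: K]) (hK : hausdorff_space K)
    (K0 : [set: K] !=set0)
    (X : completeNormedModType R[i])
    (A : submodClosed (Cspace cK X)) (HA : is_AKX A)
    (HQ : forall (S : X -> X) (lS : Lip0 S),
        range (QS (S := A) lS) `<=` [set` A]) :
  nL X = nL (subspace_type A).
Proof.
apply/eqP; rewrite eq_le (nL_AKX_ge HA K0)/=.
exact: nL_AKX_le.
Qed.
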